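(* Let $T$ be a nonempty tree (i.e. a tree with at least one edge) with root $v_0$, and let $G$ be a finite properly edge-colored subgraph of the infinite hypercube $Q_\infty$ with $\delta(G)\geq e(T)$. Suppose $\phi\colon \lfloor T/2\rfloor\to G$ is a doubly distinct homomorphism. Let $z_{\mathrm{bad}}$ be a neighbor of $\phi(v_0)$ in $Q_\infty-E(G)$ (that is, $\phi(v_0)z_{\mathrm{bad}}$ is an edge of $Q_\infty$ which is not an edge of $G$), with the property that $\phi$ maps no edge of $\lfloor T/2\rfloor$ to an edge with the same coordinate as the edge $\phi(v_0)z_{\mathrm{bad}}$. Then $\phi$ extends to a rainbow embedding of $T$ into $G-z_{\mathrm{bad}}$ whose restriction to $\lceil T/2\rceil$ is path-distinct.
   Context: Hypercube: $Q_\infty$ is the graph with vertex set $\{0,1\}^{\mathbb N}$ in which two vertices are adjacent if and only if they differ in exactly one coordinate. The coordinate of an edge $xy\in E(Q_\infty)$ is the unique $i\in\mathbb N$ at which $x$ and $y$ differ. $\delta(G)$ is the minimum degree of $G$ and $e(T)$ is the number of edges of $T$. An edge-coloring is proper if distinct edges sharing an endpoint have different colors. $G-z_{\mathrm{bad}}$ is $G$ with the vertex $z_{\mathrm{bad}}$ deleted (if it belongs to $G$). Rooted trees: let $T$ be a tree with root $v_0$. The descendants of a vertex $v$ are the vertices $w$ such that the unique path from $v_0$ to $w$ contains $v$ (so $v$ is a descendant of itself). A leaf is a vertex with no descendants other than itself (so $v_0$ is not a leaf unless $T$ is a single vertex). The level of $v$ is $\lambda(v):=\mathrm{dist}_T(v,v_0)$,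 and $\lambda_{\max}(v)$ is the greatest level among all descendants of $v$. $\lfloor T/2\rfloor$ and $\lceil T/2\rceil$ are the subtrees of $T$ rooted at $v_0$ induced by the vertex sets $\{v\in V(T):\lambda(v)\le \lfloor\lambda_{\max}(v)/2\rfloor\}$ and $\{v\in V(T):\lambda(v)\le \lceil\lambda_{\max}(v)/2\rceil\}$, respectively, where $\lambda$ and $\lambda_{\max}$ are computed in $T$. Homomorphisms: a homomorphism $\phi\colon F\to G$ is a map $V(F)\to V(G)$ sending edges of $F$ to edges of $G$; for an edge $e=xy$ write $\phi(e)=\phi(x)\phi(y)$. It is an embedding if it is injective on vertices. A homomorphism from a rooted tree $T$ with root $v_0$ to $G$ is: rainbow if the edges of $T$ are all mapped to edges of pairwise different colors; distinctly directed on a set $E\subseteq E(T)$ if distinct edges of $E$ are mapped to edges with different coordinates; distinctly directed if it is distinctly directed on $E(T)$; doubly distinct if it is both rainbow and distinctly directed; path-distinct if for every leaf $v$ of $T$ it is distinctly directed on the edge set of the path from $v_0$ to $v$. A homomorphism $\Phi$ extends $\phi$ if the domain of $\Phi$ contains that of $\phi$ and they agree on the domain of $\phi$. *)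

(* Defs.v *)
From mathcomp Require Import all_boot finmap boolp.

Set Implicit Arguments.
Unset Strict Implicit.
Unset Printing Implicit Defensive.

Local Open Scope fset_scope.

(* Finite simple graphs whose vertices lie in an arbitrary choiceType.  An edge
   xy is represented, as a single object, by the unordered pair [fset x; y]. *)
Record graph (V : choiceType) := Graph {
  verts : {fset V};
  adj : rel V;
  adj_sym : symmetric adj;
  adj_irr : irreflexive adj;
  adj_verts : forall x y, adj x y -> x \in verts }.

Section Graphs.
Variable V : choiceType.
Implicit Types (F : graph V) (S : {fset V}) (r v w x y : V) (p : seq V).

Definition neighbors F x : {fset V} := [fset y in verts F | adj F x y].

Definition edges F : {fset {fset V}} :=
  [fset [fset x; y] | x in verts F, y in neighbors F x].

Definition num_edges F : nat := #|` edges F|.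

Definition degree F x : nat := #|` neighbors F x|.

(* The default value #|` verts F| exceeds every degree, so it only matters for
   the graph without vertices (whose minimum degree is then 0). *)
Definition min_degree F : nat :=
  \big[minn/#|` verts F|]_(x <- verts F) degree F x.

Definition induced_adj F S : rel V :=
  [rel x y | [&& x \in S, y \in S & adj F x y]].

Lemma induced_adj_sym F S : symmetric (induced_adj F S).
Proof. by move=> x y; rewrite /induced_adj /= (adj_sym F x y) andbCA. Qed.

Lemma induced_adj_irr F S : irreflexive (induced_adj F S).
Proof. by move=> x; rewrite /induced_adj /= (adj_irr F x) !andbF. Qed.

Lemma induced_adj_verts F S x y :
  induced_adj F S x y -> x \in verts F `&` S.
Proof. by case/and3P=> xS _ xy; rewrite inE xS (adj_verts xy). Qed.

Definition induced F S : graph V :=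
  Graph (@induced_adj_sym F S) (@induced_adj_irr F S) (@induced_adj_verts F S).

Definition delete_vertex F x : graph V := induced F (verts F `\ x).

Definition is_path F x p y : Prop :=
  [/\ path (adj F) x p, uniq (x :: p) & last x p = y].

Definition connected F : Prop :=
  {in verts F &, forall x y, exists p, is_path F x p y}.

Definition acyclic F : Prop :=
  forall p, 2 < size p -> ~ ucycle (adj F) p.

Definition is_tree F : Prop := [/\ verts F != fset0, connected F & acyclic F].

(* The value is #|` verts F| if there is no path from x to y. *)
Definition dist F x y : nat :=
  find (fun n => `[< exists2 p, is_path F x p y & size p = n >])
       (iota 0 #|` verts F|).

(* For a tree F with root r. *)
Definition descendant F r v w : bool :=
  `[< exists2 p, is_path F r p w & v \in r :: p >].

Definition leaf F r v : Prop :=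
  v \in verts F /\ forall w, descendant F r v w -> w = v.

Definition level F r v : nat := dist F v r.

Definition level_max F r v : nat :=
  \max_(w <- verts F | descendant F r v w) level F r w.

Definition floor_half F r : graph V :=
  induced F [fset v in verts F | level F r v <= (level_max F r v)./2].

Definition ceil_half F r : graph V :=
  induced F [fset v in verts F | level F r v <= uphalf (level_max F r v)].

Definition path_edges x p : seq {fset V} :=
  pairmap (fun y z => [fset y; z]) x p.

End Graphs.

Notation cube := (nat -> bool).

(* The infinite hypercube is given by its adjacency relation on cube: x and y
   are adjacent, with coordinate i, when i is the unique place where they
   differ. *)
Definition edge_coord (x y : cube) (i : nat) : Prop :=
  unique (fun j => x j != y j) i.

Definition cube_adj (x y : cube) : Prop := exists i, edge_coord x y i.

Definition cube_subgraph (G : graph cube) : Prop :=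
  forall x y, adj G x y -> cube_adj x y.

(* A colouring is a function on unordered pairs; only its values on edges of
   G are ever used. *)
Definition proper_coloring (C : Type) (G : graph cube) (c : {fset cube} -> C)
    : Prop :=
  forall x y z, adj G x y -> adj G x z -> y <> z ->
    c [fset x; y] <> c [fset x; z].

(* A map defined on the vertices of F is represented by a total function on V,
   whose values outside verts F are irrelevant. *)
Section Homomorphisms.
Variables (V : choiceType) (C : Type).
Implicit Types (F : graph V) (G : graph cube) (c : {fset cube} -> C).
Implicit Types (f : V -> cube) (E : {pred {fset V}}).

Definition homomorphism F G f : Prop :=
  {in verts F, forall x, f x \in verts G} /\
  forall x y, adj F x y -> adj G (f x) (f y).

Definition embedding F G f : Prop :=
  homomorphism F G f /\ {in verts F &, injective f}.

Definition extends F f g : Prop := {in verts F, g =1 f}.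

Definition rainbow F c f : Prop :=
  forall x y u v, [fset x; y] \in edges F -> [fset u; v] \in edges F ->
    c [fset f x; f y] = c [fset f u; f v] -> [fset x; y] = [fset u; v].

Definition distinctly_directed_on E f : Prop :=
  forall x y u v i, [fset x; y] \in E -> [fset u; v] \in E ->
    edge_coord (f x) (f y) i -> edge_coord (f u) (f v) i ->
    [fset x; y] = [fset u; v].

Definition distinctly_directed F f : Prop :=
  distinctly_directed_on [in edges F] f.

Definition doubly_distinct F c f : Prop :=
  rainbow F c f /\ distinctly_directed F f.

Definition path_distinct F r f : Prop :=
  forall v p, leaf F r v -> is_path F r p v ->
    distinctly_directed_on [in path_edges r p] f.

End Homomorphisms.

(* Main.v *)
Require Import Defs.
From mathcomp Require Import all_boot finmap boolp zify.

Set Implicit Arguments.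
Unset Strict Implicit.
Unset Printing Implicit Defensive.

(** A map to the cube is studied through the directions of the edges: a vertex
    of the tree is named by the word of the vertices on its path from the root,
    every nonempty word carries a direction, and a word is placed where the
    directions on its path lead. Two vertices collide when each direction
    occurs oddly often on both paths or on none; in a sequence where all
    entries occur evenly often, at most half of the positions can carry
    distinct entries (uniq_even_size). Since the first halves of the paths
    have distinct directions, hardly any collision can occur, and the proof
    consists in excluding the remaining ones.

    The theorem is proved by induction on the number of edges, for a root
    together with some of its branches. A single branch, with child v of the
    root r, is treated by labelling its ceiling half greedily, doubly
    distinctly and away from the direction of the bad neighbour. This is
    possible because a half contains about half of the edges (forest_half) and
    each labelled edge excludes a colour and a direction. The bad neighbour is
    then avoided whatever comes next (branch_avoid). Seen from v, the ceiling
    half has become the floor half of a tree with one edge less (ceil_branch),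
    and the induction hypothesis applies in the graph without the colour of
    the edge from r to v; the position of r is no longer a neighbour of v in
    this graph and plays the part of the bad neighbour (branch_complete).

    When there are several branches, one branch gets its ceiling half, the
    others are completed in a graph without colours and directions of this
    half, and at last the branch itself is completed in a graph without the
    colours of the others. If the ceiling half has at most half of the edges
    of the branch, all its colours and directions can be spared, and no
    collision is possible (completable_loose).

    Otherwise all leaves of all branches have odd level and only floor
    directions can be spared. A collision then happens next to the root, in a
    ceiling direction of the branch. Such points are avoided by means of one
    extra edge at each vertex, which allows completing a branch without the
    direction of its first edge, hence without coming back to a neighbour of
    the root (complete_with_slack). The extra edge is found by setting aside
    two branches instead of one; these two do not collide with each other
    because their ceiling halves together carry more than half of the
    directions on any two of their paths (tight_apart, completable_tight). *)

(** * Sequences in which entries occur evenly often *)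

Section Parity.
Variable I : eqType.
Implicit Types (p q u : seq I).

Lemma double_uniq_count u q :
  uniq u -> {subset u <= q} -> {in u, forall i, ~~ odd (count_mem i q)} ->
  forall i, count_mem i (u ++ u) <= count_mem i q.
Proof.
move=> Uu uq ev i; rewrite count_cat count_uniq_mem //.
have [iu|//] := boolP (i \in u).
have := ev i iu; have: 0 < count_mem i q by rewrite -has_count has_pred1 uq.
by case: (count_mem i q) => [|[|n]].
Qed.

(** An entry that occurs evenly often occurs at least twice, so distinct
    entries of this kind fill at most half of the sequence. All collisions of
    two vertices in the cube are excluded by this count. *)
Lemma uniq_even_size u q :
  uniq u -> {subset u <= q} -> {in u, forall i, ~~ odd (count_mem i q)} ->
  (size u).*2 <= size q.
Proof.
move=> Uu uq ev; have /count_subseqP[s sq us] := double_uniq_count Uu uq ev.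
by rewrite -addnn -size_cat (perm_size us) size_subseq.
Qed.

(** Each entry of the first half has a second occurrence, so that the first
    half taken twice leaves at most one entry. If there is one, it is the
    middle entry, which differs from the entries before it. *)
Lemma parity_of_half p :
  uniq (take (uphalf (size p)) p) ->
  {in take (size p)./2 p, forall i, ~~ odd (count_mem i p)} ->
  (forall i, ~~ odd (count_mem i p)) \/
  exists2 d, d \in take (uphalf (size p)) p &
    forall i, odd (count_mem i p) = (i == d).
Proof.
set h := (size p)./2; set k := uphalf _ => Uk ev.
have hk : h <= k by rewrite /h /k; lia.
have hs : h <= size p by rewrite /h -{2}[size p]odd_double_half -addnn; lia.
have Uh : uniq (take h p) by rewrite -(take_takel p hk) take_uniq.
have sub : {subset take h p <= p} by move=> i; exact: mem_take.
have /count_subseqP[s sp us] := double_uniq_count Uh sub ev.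
have [rest pr] := perm_to_subseq sp.
have odd_rest i : odd (count_mem i p) = odd (count_mem i rest).
  rewrite (permP pr) count_cat -(permP us) count_cat oddD oddD addbb //.
have szr : size rest = odd (size p).
  have := perm_size pr; rewrite size_cat -(perm_size us) size_cat (size_takel hs).
  by have := odd_double_half (size p); rewrite -/h -addnn; lia.
case: rest pr odd_rest szr => [|d [|e rest]] pr odd_rest /= szr; last by lia.
  by left=> i; rewrite odd_rest.
right; exists d; last first.
  by move=> i; rewrite odd_rest /= addn0 oddb eq_sym.
have op : odd (size p) by lia.
have hp : h < size p by rewrite /h; lia.
have kh : k = h.+1 by rewrite /k /h; lia.
have [x0 _] : exists x : I, x \in p by case: (p) hp => // x p' _; exists x; rewrite mem_head.
have ep : nth x0 p h \in p by rewrite mem_nth.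
move: Uk; rewrite kh (take_nth x0) // rcons_uniq => /andP[enu _].
have := ep; rewrite (perm_mem pr) mem_cat -(perm_mem us) mem_cat orbb (negPf enu) inE => /eqP <-.
by rewrite mem_rcons inE eqxx.
Qed.

End Parity.

(** * Prefixes of words *)

Section Words.
Variable A : eqType.
Implicit Types (u v w r : seq A) (a b : A) (K : seq A).

Lemma prefix_leq u w : prefix u w -> size u <= size w.
Proof. by case/prefixP=> s ->; rewrite size_cat leq_addr. Qed.

Lemma prefix_comparable u v w :
  prefix u w -> prefix v w -> size u <= size v -> prefix u v.
Proof.
rewrite !prefixE => /eqP uw /eqP vw uv; apply/eqP.
by rewrite -vw take_takel.
Qed.

Lemma prefix_size_eq u v w :
  prefix u w -> prefix v w -> size u = size v -> u = v.
Proof. by rewrite !prefixE => /eqP {2}<- /eqP {2}<- ->. Qed.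

Lemma prefix_rcons_inj r a b w :
  prefix (rcons r a) w -> prefix (rcons r b) w -> a = b.
Proof.
move=> pa pb; have := prefix_size_eq pa pb; rewrite !size_rcons => /(_ erefl).
by case/rcons_inj.
Qed.

Lemma prefix_next r w :
  prefix r w -> size r < size w -> exists a, prefix (rcons r a) w.
Proof.
case/prefixP=> [[|a s] ->]; rewrite ?cats0 ?ltnn // => _.
by exists a; rewrite -cat_rcons prefix_prefix.
Qed.

Definition parent w := take (size w).-1 w.

Lemma parent_rcons w a : parent (rcons w a) = w.
Proof. by rewrite /parent size_rcons -cats1 take_size_cat. Qed.

Lemma size_parent w : size (parent w) = (size w).-1.
Proof. by rewrite size_takel // leq_pred. Qed.

Lemma prefix_parent w : prefix (parent w) w.
Proof. exact: prefix_take. Qed.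

(** The words on the path from r to w, without r. Each of them stands for the
    edge that joins it to its parent. *)
Definition lineage r w := [seq take k w | k <- iota (size r).+1 (size w - size r)].

Lemma size_lineage r w : size (lineage r w) = size w - size r.
Proof. by rewrite size_map size_iota. Qed.

Lemma mem_take_lineage n r w u :
  size r <= size w ->
  (u \in take n (lineage r w)) = [&& prefix u w, size r < size u & size u <= size r + n].
Proof.
move=> rw; rewrite -map_take take_iota; apply/mapP/and3P.
  case=> k; rewrite mem_iota => kP ->; rewrite prefix_take size_takel; last by lia.
  by split=> //; lia.
case=> uw ru un; exists (size u); last by move: uw; rewrite prefixE => /eqP.
by have := prefix_leq uw; rewrite mem_iota; lia.
Qed.

Lemma mem_lineage r w u :
  size r <= size w -> (u \in lineage r w) = prefix u w && (size r < size u).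
Proof.
move=> rw; rewrite -[lineage r w]take_size mem_take_lineage // size_lineage subnKC //.
by case uw: prefix => //=; rewrite (prefix_leq uw) andbT.
Qed.

Lemma lineage_uniq r w : uniq (lineage r w).
Proof.
rewrite map_inj_in_uniq ?iota_uniq // => i j; rewrite !mem_iota => iP jP.
by move/(congr1 size); rewrite !size_takel; lia.
Qed.

Lemma lineage_cat r w : prefix r w -> lineage [::] w = lineage [::] r ++ lineage r w.
Proof.
move=> rw; have le := prefix_leq rw; rewrite /lineage !subn0 /=.
rewrite -{1}(subnKC le) iotaD map_cat add1n; congr (_ ++ _).
apply/eq_in_map=> k; rewrite mem_iota => kP.
by move: rw; rewrite prefixE => /eqP <-; rewrite take_takel //; lia.
Qed.

Lemma lineage_rcons r w a : size r <= size w ->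
  lineage r (rcons w a) = rcons (lineage r w) (rcons w a).
Proof.
move=> rw; rewrite /lineage size_rcons subSn // -[(_ - _).+1]addn1 iotaD map_cat /= -[in RHS]cats1.
congr cat; last by rewrite take_oversize // size_rcons; lia.
apply/eq_in_map=> k; rewrite mem_iota => kP.
by rewrite -cats1 takel_cat //; lia.
Qed.

End Words.

(** * Edges of the cube, colours and degrees *)

Definition flip (x : cube) (i : nat) : cube := fun j => x j (+) (j == i).

Lemma flipK i : involutive (flip^~ i).
Proof. by move=> x; apply: funext => j; rewrite /flip addbK. Qed.

Lemma flip_inj x : injective (flip x).
Proof.
move=> i j /(congr1 (fun y => y i)); rewrite /flip eqxx => /addbI /esym.
by move=> /eqP.
Qed.

Lemma flip_neq (x : cube) i : flip x i <> x.
Proof. by move=> /(congr1 (fun y => y i)); rewrite /flip eqxx addbT; case: (x i). Qed.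

Lemma sub_count_lt (T : eqType) (P Q : pred T) (s : seq T) w :
  (forall u, P u -> Q u) -> w \in s -> Q w -> ~~ P w -> count P s < count Q s.
Proof.
move=> PQ ws Qw nPw.
have -> : count Q s = count P s + count (fun u => Q u && ~~ P u) s.
  rewrite -count_predUI [X in _ + X](_ : _ = 0) ?addn0.
    by apply: eq_count => u /=; case Pu: (P u); rewrite ?(PQ _ Pu) ?andbT.
  by apply/eqP; rewrite eqn0Ngt -has_count; apply/hasPn => u _ /=; case: (P u); rewrite ?andbF.
rewrite -[leqLHS]addn1 leq_add2l -has_count; apply/hasP; exists w => //.
by rewrite Qw.
Qed.

Lemma count_or_leq (T : Type) (P Q : pred T) (s : seq T) :
  count (fun y => P y || Q y) s <= count P s + count Q s.
Proof. by rewrite -count_predUI leq_addr. Qed.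

Section Degree.
Variables (C : eqType) (colour : cube -> nat -> C).
Implicit Types (E : cube -> pred nat) (X : seq C) (Y : seq nat).

(** A lower bound on the degree, witnessed by a list of directions: deleting
    edges from the graph then amounts to filtering the list. *)
Definition deg_ge E x n := exists s : seq nat, [/\ uniq s, all (E x) s & n <= size s].

Definition proper_at E := forall x i j, E x i -> E x j -> colour x i = colour x j -> i = j.

Definition del_edges E X Y : cube -> pred nat :=
  fun x i => [&& E x i, colour x i \notin X & i \notin Y].

Lemma deg_leq E x m n : m <= n -> deg_ge E x n -> deg_ge E x m.
Proof. by move=> mn [s [Us sE sn]]; exists s; split=> //; apply: leq_trans sn. Qed.

Lemma deg_mono E E' x n : (forall i, E x i -> E' x i) -> deg_ge E x n -> deg_ge E' x n.
Proof.
by move=> sub [s [Us sE sn]]; exists s; split=> //; apply: sub_all sE => i; apply: sub.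
Qed.

Lemma del_sub E X Y x i : del_edges E X Y x i -> E x i.
Proof. by case/and3P. Qed.

Lemma proper_sub E E' : (forall x i, E' x i -> E x i) -> proper_at E -> proper_at E'.
Proof. by move=> sub pE x i j /sub Ei /sub Ej; apply: pE. Qed.

(** By properness every colour excludes at most one edge at x. *)
Lemma deg_del E X Y x m n :
  proper_at E -> deg_ge E x m -> n + size X + size Y <= m -> deg_ge (del_edges E X Y) x n.
Proof.
move=> pE [s [Us /allP sE sm]] le.
exists [seq i <- s | (colour x i \notin X) && (i \notin Y)]; split.
- by rewrite filter_uniq.
- by apply/allP => i; rewrite mem_filter => /andP[ok /sE Ei]; rewrite /del_edges Ei.
have bX : count (fun i => colour x i \in X) s <= size X.
  rewrite -size_filter -(size_map (colour x)); apply: uniq_leq_size.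
    rewrite map_inj_in_uniq ?filter_uniq // => i j; rewrite !mem_filter.
    by move=> /andP[_ /sE Ei] /andP[_ /sE Ej]; apply: pE.
  by move=> k /mapP[i]; rewrite mem_filter => /andP[iX _] ->.
have bY : count [in Y] s <= size Y.
  rewrite -size_filter; apply: uniq_leq_size; first by rewrite filter_uniq.
  by move=> i; rewrite mem_filter => /andP[].
rewrite size_filter -(leq_add2r (size X + size Y)) addnA.
apply: leq_trans (leq_trans le sm) _.
apply: leq_trans (leq_add (leqnn _) (leq_add bX bY)).
rewrite -[count (fun i => colour x i \in X) s + _]count_predUI.
rewrite -(count_predC (fun i => (colour x i \notin X) && (i \notin Y))) leq_add2l.
apply: leq_trans (leq_addr _ _); apply: sub_count => i /=.
by rewrite negb_and !negbK.
Qed.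

Lemma free_direction E X Y x n :
  proper_at E -> deg_ge E x n -> size X + size Y < n -> exists i, del_edges E X Y x i.
Proof.
move=> pE dE lt; have := @deg_del E X Y x n 1 pE dE.
rewrite -addnA add1n => /(_ lt) [[|i s] [_ sE sz]] //.
by case/andP: sE => Ei _; exists i.
Qed.

(** The direction j costs nothing: the edge that it would exclude is absent,
    or is excluded by its colour as well. Typically j is the direction of the
    edge from x towards the root. *)
Lemma free_direction_overlap E X Y x n j :
  proper_at E -> deg_ge E x n -> size X + size Y <= n ->
  j \in Y -> (E x j -> colour x j \in X) -> exists i, del_edges E X Y x i.
Proof.
move=> pE dE le jY ov; have [|i] := @free_direction E X (rem j Y) x n pE dE.
  by rewrite size_rem // -addnS prednK //; case: (Y) jY.
rewrite /del_edges => /and3P[Ei iX iY]; exists i; rewrite /del_edges Ei iX /=.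
have ij : i != j by apply: contraNneq iX => ij; rewrite ij ov -?ij.
apply: contra iY => iY; have := perm_to_rem jY => /perm_mem/(_ i).
by rewrite iY inE (negPf ij).
Qed.

End Degree.

(** * Positions of words labelled by directions *)

Section Positions.
Variables (A : eqType) (x0 : cube).
Implicit Types (u v w r : seq A) (a b : A) (d : seq A -> nat).
Implicit Types (S Z : pred (seq A)).

Definition dir_seq d r w := [seq d u | u <- lineage r w].
(** The base word is at x0, and each edge on the path switches the coordinate
    that labels it. *)
Definition pos d w : cube := fun j => x0 j (+) odd (count_mem j (dir_seq d [::] w)).

Lemma pos_rel d r w j : prefix r w ->
  pos d w j = pos d r j (+) odd (count_mem j (dir_seq d r w)).
Proof.
by move=> rw; rewrite /pos /dir_seq (lineage_cat rw) map_cat count_cat oddD addbA.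
Qed.

Lemma pos_rcons d u a : pos d (rcons u a) = flip (pos d u) (d (rcons u a)).
Proof.
apply: funext => j; rewrite (pos_rel d j (prefix_rcons u a)) /flip /dir_seq lineage_rcons //.
by rewrite /lineage subnn /= addn0 oddb eq_sym.
Qed.

Lemma word_rcons r w : size r < size w -> exists a, w = rcons (parent w) a.
Proof.
case/lastP: w => [|w a]; first by rewrite ltn0.
by move=> _; exists a; rewrite parent_rcons.
Qed.

Lemma pos_parent d w r : size r < size w -> pos d w = flip (pos d (parent w)) (d w).
Proof. by case/word_rcons => a -> ; rewrite pos_rcons parent_rcons. Qed.

Lemma pos_evenP d r w : prefix r w ->
  (forall j, ~~ odd (count_mem j (dir_seq d r w))) <-> pos d w = pos d r.
Proof.
move=> rw; split=> [ev|eqp j].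
  by apply: funext => j; rewrite (pos_rel d j rw) (negPf (ev j)) addbF.
by have := pos_rel d j rw; rewrite eqp => /esym; case: (pos d r j); case: odd.
Qed.

Lemma pos_flipP d r w i : prefix r w ->
  (forall j, odd (count_mem j (dir_seq d r w)) = (j == i)) <-> pos d w = flip (pos d r) i.
Proof.
move=> rw; split=> [ev|eqp j].
  by apply: funext => j; rewrite (pos_rel d j rw) ev.
by have := pos_rel d j rw; rewrite eqp /flip => /addbI ->.
Qed.

Lemma pos_eq_parity d r w w' : prefix r w -> prefix r w' -> pos d w = pos d w' ->
  forall j, odd (count_mem j (dir_seq d r w)) = odd (count_mem j (dir_seq d r w')).
Proof.
move=> rw rw' eqp j; have := pos_rel d j rw; rewrite eqp (pos_rel d j rw').
by move/addbI.
Qed.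

(** Used with Z the set of the words that a step of the construction labels.
    *)
Definition agree_off Z d d' := forall u, ~~ Z u -> d' u = d u.

Lemma agree_off_trans Z d d' d'' :
  agree_off Z d d' -> agree_off Z d' d'' -> agree_off Z d d''.
Proof. by move=> h h' u nz; rewrite h' // h. Qed.

Lemma agree_off_sub Z Z' d d' :
  (forall u, Z u -> Z' u) -> agree_off Z d d' -> agree_off Z' d d'.
Proof. by move=> sub h u nz; apply: h; apply: contra nz; apply: sub. Qed.

Lemma pos_agree d d' w : (forall u, prefix u w -> d' u = d u) -> pos d' w = pos d w.
Proof.
move=> h; apply: funext => j; rewrite /pos /dir_seq; congr (_ (+) odd (count _ _)).
by apply/eq_in_map => u; rewrite mem_lineage // => /andP[uw _]; apply: h.
Qed.

End Positions.

(** * Forests of words and their halves *)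

Lemma sum_bound f1 s o1 o D d F O : f1.*2 + s + 1 + o1 <= d + 1 -> F.*2 + O <= D ->
  o <= o1 + O -> (1 + (f1 + F)).*2 + s + o <= 1 + (d + D) + 1.
Proof. lia. Qed.

Lemma lt_max s t m : s < t -> (t - s).*2 <= m - s -> t < m.
Proof. lia. Qed.

Lemma nothalf_max s t m : ~~ (t.+1 - s <= (m - s)./2) -> m - s <= (t - s).*2.+1.
Proof. lia. Qed.

Lemma nothalf_anti s t m m' :
  m' <= m -> ~~ (t - s <= (m - s)./2) -> ~~ (t - s <= (m' - s)./2).
Proof. lia. Qed.

Lemma chain_bound s t m c : (t - s).*2 <= m - s -> m - t + 1 + 0 <= c ->
  2 + (t - s) + 0 <= c + 1.
Proof. lia. Qed.

Lemma chain_bound1 s t m c : (t - s).*2 <= m - s -> m - t + 1 + 1 <= c ->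
  2 + (t - s) + 1 <= c + 1.
Proof. lia. Qed.

Lemma chain_bound_odd s t m c : s < t -> (t - s).*2 <= m - s -> odd (m - s) ->
  m - t + 1 + 0 <= c -> 2 + (t - s) + 1 <= c + 1.
Proof. lia. Qed.

Section Forests.
Variables (A : eqType) (N : seq (seq A)).
Implicit Types (u v w r : seq A) (a b : A) (K : seq A) (Q : pred (seq A)).

Definition max_level w := \max_(u <- N | prefix w u) size u.

Lemma max_level_ge w u : u \in N -> prefix w u -> size u <= max_level w.
Proof. by move=> uN wu; apply: leq_bigmax_seq. Qed.

Lemma max_level_anti u w : prefix u w -> max_level w <= max_level u.
Proof.
move=> uw; apply/bigmax_leqP_seq => v vN wv.
exact/max_level_ge/(prefix_trans uw).
Qed.

Lemma max_level_witness w : w \in N -> exists u, [/\ u \in N, prefix w u & size u = max_level w].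
Proof.
move=> wN; suff /hasP[u uN /andP[wu /eqP]] :
  has (fun u => prefix w u && (size u == max_level w)) N by exists u.
apply/negPn/negP=> /hasPn /= H.
have : max_level w <= (max_level w).-1.
  apply/bigmax_leqP_seq => u uN wu; have := H u uN; rewrite wu /= => /eqP.
  by have := max_level_ge uN wu; lia.
have := max_level_ge wN (prefix_refl w).
by have := H w wN; rewrite prefix_refl /= => /eqP; lia.
Qed.

Definition children v := [seq a <- undup (flatten N) | rcons v a \in N].

Lemma children_uniq v : uniq (children v).
Proof. by rewrite filter_uniq // undup_uniq. Qed.

Lemma mem_children v a : (a \in children v) = (rcons v a \in N).
Proof.
rewrite mem_filter mem_undup; case vaN: (_ \in N) => //=.
by apply/flattenP; exists (rcons v a); rewrite // mem_rcons inE eqxx.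
Qed.

Definition desc v w := (w \in N) && prefix v w.

(** The vertices other than r of the rooted tree formed by r and its branches
    through the letters in K. They correspond to the edges of that tree, so
    counting them counts edges. All the trees in the induction have this form:
    a vertex of such a tree other than r keeps all its descendants, and
    therefore its max_level. *)
Definition forest r K w := (w \in N) && has (fun b => prefix (rcons r b) w) K.

Lemma forest1 r b : forest r [:: b] =1 desc (rcons r b).
Proof. by move=> w; rewrite /forest /= orbF. Qed.

Lemma forest_cons r b K w : forest r (b :: K) w = forest r [:: b] w || forest r K w.
Proof. by rewrite /forest /= orbF andb_orr. Qed.

Lemma forestP r K w : reflect (exists2 b,
  b \in K & w \in N /\ prefix (rcons r b) w) (forest r K w).
Proof.
apply: (iffP andP) => [[wN /hasP[b bK bw]]|[b bK [wN bw]]]; first by exists b.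
by split=> //; apply/hasP; exists b.
Qed.

Lemma forest_N r K w : forest r K w -> w \in N. Proof. by case/andP. Qed.

Lemma forest_root r K w : forest r K w -> prefix r w /\ size r < size w.
Proof.
case/forestP=> b _ [_ bw]; split; first exact/(prefix_trans (prefix_rcons r b)).
by have := prefix_leq bw; rewrite size_rcons.
Qed.

Definition anc_closed r (S : pred (seq A)) :=
  forall u w, S w -> prefix u w -> size r < size u -> S u.

Lemma forest_disjoint r b K w : b \notin K -> forest r [:: b] w -> forest r K w -> False.
Proof.
move=> bK /forestP[c]; rewrite inE => /eqP -> [_ bw] /forestP[d dK [_ dw]].
by case/negP: bK; rewrite (prefix_rcons_inj bw dw).
Qed.

Hypothesis Nprefix : forall u w, prefix u w -> w \in N -> u \in N.

Lemma forest_closed r K : anc_closed r (forest r K).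
Proof.
move=> u w /forestP[b bK [wN bw]] uw ru; apply/forestP; exists b => //.
split; first exact: Nprefix uw wN.
by apply: prefix_comparable bw uw _; rewrite size_rcons.
Qed.

Lemma forest_children v : forest v (children v) =1 (fun w => desc v w && (w != v)).
Proof.
move=> w; apply/idP/idP.
  case/forestP=> a _ [wN aw]; rewrite /desc wN (prefix_trans (prefix_rcons v a) aw) /=.
  apply/eqP=> vw; have := prefix_leq aw; rewrite size_rcons vw; lia.
case/andP=> /andP[wN vw] wv; have [|a aw] := prefix_next vw.
  rewrite ltn_neqAle prefix_leq // andbT; apply: contra wv => /eqP s.
  by apply/eqP/esym/(prefix_size_eq vw (prefix_refl w)).
by apply/forestP; exists a => //; rewrite mem_children; apply: Nprefix aw wN.
Qed.

Hypothesis Nuniq : uniq N.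

Lemma count_forest r K Q : uniq K ->
  count (fun w => forest r K w && Q w) N =
  \sum_(b <- K) count (fun w => desc (rcons r b) w && Q w) N.
Proof.
move=> UK; under eq_bigr do rewrite -sum1_count big_mkcond /=.
rewrite exchange_big -sum1_count big_mkcond /=; apply: eq_bigr => w _.
case wQ: (Q w); last by rewrite andbF big1 // => b _; rewrite andbF.
under eq_bigr do rewrite andbT.
rewrite andbT -big_mkcond sum1_count; case: forestP => [[b bK [wN bw]]|nK].
  rewrite (eq_in_count (_ : {in K, _ =1 pred1 b})) ?count_uniq_mem ?bK //.
  move=> c cK; rewrite /desc wN /=; apply/idP/eqP => [cw|->//].
  exact: prefix_rcons_inj cw bw.
apply/esym/eqP; rewrite eqn0Ngt -has_count; apply/hasPn => b bK.
by apply/negP=> /andP[wN bw]; apply: nK; exists b.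
Qed.

Lemma count_desc v Q : v \in N ->
  count (fun w => desc v w && Q w) N =
  Q v + \sum_(a <- children v) count (fun w => desc (rcons v a) w && Q w) N.
Proof.
move=> vN; rewrite -count_forest ?children_uniq //.
have -> : (Q v : nat) = count (fun w => (w == v) && Q w) N.
  rewrite (eq_count (_ : _ =1 (fun w => Q v && (w == v)))); last first.
    by move=> w /=; rewrite andbC; case: eqP => [->|]; rewrite ?andbF.
  by case: (Q v); rewrite ?count_pred0 //= count_uniq_mem // vN.
rewrite -count_predUI [X in _ + X](_ : _ = 0) ?addn0.
  apply: eq_count => w /=; rewrite forest_children /desc; case: eqP => [->|_];
    last by rewrite andbT.
  by rewrite andbF orbF vN prefix_refl.
apply/eqP; rewrite eqn0Ngt -has_count; apply/hasPn => w wN /=; rewrite forest_children.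
by case: eqP; rewrite ?andbF.
Qed.

Definition in_floor r w := size w - size r <= (max_level w - size r)./2.
Definition in_ceil r w := size w - size r <= uphalf (max_level w - size r).
Definition floor_of r K w := forest r K w && in_floor r w.
Definition ceil_of r K w := forest r K w && in_ceil r w.

Definition odd_leaf r v :=
  has (fun w => [&& desc v w, max_level w == size w & odd (size w - size r)]) N.

Local Notation desc_size v := (count (desc v) N).
Local Notation floor_size r v := (count (fun w => desc v w && in_floor r w) N).

Lemma in_floor_anti r u w : prefix u w -> in_floor r w -> in_floor r u.
Proof.
move=> uw /(leq_trans (leq_sub2r _ (prefix_leq uw))) /leq_trans; apply.
exact/half_leq/leq_sub2r/max_level_anti.
Qed.

Lemma in_ceil_anti r u w : prefix u w -> in_ceil r w -> in_ceil r u.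
Proof.
move=> uw /(leq_trans (leq_sub2r _ (prefix_leq uw))) /leq_trans; apply.
exact/uphalf_leq/leq_sub2r/max_level_anti.
Qed.

Lemma desc_size_rec v : v \in N -> desc_size v = 1 + \sum_(a <- children v) desc_size (rcons v a).
Proof.
move=> vN; have := count_desc xpredT vN.
rewrite (eq_count (_ : _ =1 desc v)) => [->|w]; last by rewrite andbT.
by congr (_ + _); apply: eq_bigr => a _; apply: eq_count => w; rewrite andbT.
Qed.

Lemma floor_size_rec r v : v \in N ->
  floor_size r v = in_floor r v + \sum_(a <- children v) floor_size r (rcons v a).
Proof. exact: count_desc. Qed.

Lemma odd_leaf_child r v : max_level v != size v ->
  odd_leaf r v <= \sum_(a <- children v) odd_leaf r (rcons v a).
Proof.
move=> nleaf; case: (boolP (odd_leaf r v)) => // /hasP[w wN /and3P[/andP[_ vw] leaf odd_w]].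
have vNw : v != w by apply: contraNneq nleaf => ->.
have [|a aw] := prefix_next vw.
  rewrite ltn_neqAle prefix_leq // andbT; apply: contra vNw => /eqP s.
  exact/eqP/(prefix_size_eq vw (prefix_refl w)).
have ach : a \in children v by rewrite mem_children (Nprefix aw).
rewrite (bigD1_seq a) ?children_uniq //= ltn_addr // lt0b.
by apply/hasP; exists w; rewrite // /desc wN aw leaf.
Qed.

(** The words on the path from v to u are disjoint from the words in s. *)
Lemma desc_size_chain v u s : uniq s -> {in s, forall w, desc v w && ~~ prefix w u} ->
  desc v u -> size u - size v + 1 + size s <= desc_size v.
Proof.
move=> Us sP /andP[uN vu]; have le := prefix_leq vu.
rewrite -(size_lineage v u) addn1 -/(size (v :: lineage v u)) -size_cat -size_filter.
apply: uniq_leq_size.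
  rewrite cat_uniq Us /= lineage_uniq mem_lineage // ltnn andbF /= andbT.
  apply/hasPn => w /sP /andP[_ nwu]; rewrite inE negb_or mem_lineage // (negPf nwu) andbT.
  by apply: contraNneq nwu => ->.
move=> w; rewrite mem_cat mem_filter => /orP[|/sP /andP[wP _]]; last by rewrite wP; case/andP: wP.
rewrite inE mem_lineage // => /predU1P[->|/andP[wu vw]].
  by rewrite /desc (Nprefix vu) ?prefix_refl.
by rewrite /desc (Nprefix wu) //= (prefix_comparable vu wu) // ltnW.
Qed.

(** Induction on the number of descendants, through a child that lies above a
    deepest descendant of v. If that child is not in the floor half, v is the
    only descendant of v there, and the path to a deepest descendant is long
    enough; a leaf at odd level either is off this path or makes it longer.
    The summand growing with the level accounts for the branches that leave a
    deepest path: only a path starting next to the root can have half of its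
    vertices in the floor half. *)
Lemma half_count n r v : desc_size v <= n -> v \in N -> prefix r v -> size r < size v ->
  if in_floor r v then (floor_size r v).*2 + (size v - size r) + odd_leaf r v <= desc_size v + 1
  else floor_size r v == 0.
Proof.
elim: n v => [|n IH] v vn vN rv ltrv.
  by move: vn; rewrite desc_size_rec.
case: ifPn => [hv|nhv]; last first.
  rewrite eqn0Ngt -has_count; apply/hasPn => w _.
  by apply: contra nhv => /andP[/andP[_ vw]]; apply: in_floor_anti.
have child a : a \in children v ->
    if in_floor r (rcons v a) then
      (floor_size r (rcons v a)).*2 + (size v - size r) + 1 + odd_leaf r (rcons v a) <=
        desc_size (rcons v a) + 1
    else floor_size r (rcons v a) == 0.
  move=> ach; have va := prefix_rcons v a; have aN : rcons v a \in N by rewrite -mem_children.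
  have an : desc_size (rcons v a) <= n.
    by move: vn; rewrite desc_size_rec // (bigD1_seq a) ?children_uniq //=; lia.
  have := IH (rcons v a) an aN (prefix_trans rv va); rewrite size_rcons.
  move=> /(_ (ltnW ltrv)); case: ifP => // _; rewrite subSn ?(ltnW ltrv) //.
  by clear; set x := count _ _; set y := count _ _; lia.
have childle a : a \in children v ->
    (floor_size r (rcons v a)).*2 + odd_leaf r (rcons v a) <= desc_size (rcons v a).
  move=> ach; have := child a ach; case: ifP => _; first lia.
  move=> /eqP ->; rewrite add0n; case: (boolP (odd_leaf r _)) => // /hasP[w wN /andP[wa _]].
  by rewrite -has_count; apply/hasP; exists w.
have [u [uN vu lu]] := max_level_witness vN.
have lv : (size v - size r).*2 <= max_level v - size r by move: hv; rewrite /in_floor; lia.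
(* a leads towards a deepest descendant of v *)
have [|a au] := prefix_next vu; first lia.
have aN := Nprefix au uN; have ach : a \in children v by rewrite mem_children.
have la : max_level (rcons v a) = max_level v.
  by apply/eqP; rewrite eqn_leq max_level_anti ?prefix_rcons //= -lu max_level_ge.
have nleaf : max_level v != size v by rewrite gtn_eqF // (lt_max ltrv).
have [ha|nha] := boolP (in_floor r (rcons v a)).
  have := odd_leaf_child r nleaf;
    rewrite desc_size_rec // floor_size_rec // hv !(bigD1_seq a ach) ?children_uniq //=.
  have := child a ach; rewrite ha.
  move=> le1 le2; apply: (sum_bound le1 _ le2).
  rewrite -mul2n big_distrr -big_split /= big_seq_cond [leqRHS]big_seq_cond.
  by apply: leq_sum => b /andP[bch _]; rewrite mul2n childle.
have lv2 : max_level v - size r <= (size v - size r).*2.+1.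
  by move: nha; rewrite /in_floor la size_rcons; apply: nothalf_max.
have -> : floor_size r v = 1.
  rewrite floor_size_rec // hv big_seq big1 // => b bch.
  have := child b bch; rewrite ifN => [/eqP //|]; move: nha; rewrite /in_floor !size_rcons la.
  exact/nothalf_anti/max_level_anti/prefix_rcons.
have dvu : desc v u by rewrite /desc uN.
have nilP : {in [::], forall w, desc v w && ~~ prefix w u} by [].
case: (boolP (odd_leaf r v)) => [/hasP[w wN /and3P[vw /eqP leaf odd_w]]|_] /=; last first.
  by have := @desc_size_chain v u [::] isT nilP dvu; rewrite lu; apply: chain_bound.
have [wu|nwu] := boolP (prefix w u); last first.
  have wP : {in [:: w], forall w, desc v w && ~~ prefix w u}.
    by move=> x; rewrite inE => /eqP ->; rewrite vw.
  by have := @desc_size_chain v u [:: w] isT wP dvu; rewrite lu; apply: chain_bound1.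
have := max_level_ge uN wu; have := prefix_leq wu; rewrite leaf => l1 l2.
have := @desc_size_chain v u [::] isT nilP dvu; rewrite lu.
apply: (chain_bound_odd ltrv lv); have <- : size w = max_level v => //.
by apply/eqP; rewrite eqn_leq -lu l1 l2.
Qed.

Lemma branch_half r v : v \in N -> prefix r v -> size r < size v ->
  (floor_size r v).*2 + odd_leaf r v <= desc_size v.
Proof.
move=> vN rv ltrv; have := half_count (leqnn _) vN rv ltrv; case: ifP => _; first lia.
move=> /eqP ->; rewrite add0n; case: (boolP (odd_leaf r _)) => // /hasP[w wN /andP[wa _]].
by rewrite -has_count; apply/hasP; exists w.
Qed.

(** This is what the degree condition pays for. An edge labelled with its own
    colour and its own direction excludes two edges at every other vertex,
    hence all edges of the floor half exclude no more edges than the tree has.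
    *)
Lemma forest_half r K : uniq K -> {in K, forall b, rcons r b \in N} ->
  (count (floor_of r K) N).*2 + has (fun b => odd_leaf r (rcons r b)) K <= count (forest r K) N.
Proof.
move=> UK KN; have := count_forest r xpredT UK.
rewrite (eq_count (_ : _ =1 forest r K)) => [->|w]; last by rewrite andbT.
rewrite (count_forest r (in_floor r) UK) -mul2n big_distrr /=.
have : (has (fun b => odd_leaf r (rcons r b)) K : nat) <= \sum_(b <- K) odd_leaf r (rcons r b).
  case: (boolP (has _ K)) => // /hasP[b bK ob]; rewrite (bigD1_seq b) //= ob; lia.
suff : \sum_(i <- K) 2 * floor_size r (rcons r i) + \sum_(b <- K) odd_leaf r (rcons r b)
  <= \sum_(i <- K) count (fun w => desc (rcons r i) w && true) N by lia.
rewrite -big_split /= big_seq [leqRHS]big_seq; apply: leq_sum => b bK.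
rewrite (eq_count (_ : (fun w => desc (rcons r b) w && true) =1 desc (rcons r b))); last first.
  by move=> w; rewrite andbT.
by rewrite mul2n branch_half ?KN ?prefix_rcons // size_rcons.
Qed.

Lemma count_forest_cons r b K : b \notin K ->
  count (forest r (b :: K)) N = count (forest r [:: b]) N + count (forest r K) N.
Proof.
move=> bK; rewrite -count_predUI [X in _ + X](_ : _ = 0) ?addn0.
  by apply: eq_count => w; rewrite forest_cons.
apply/eqP; rewrite eqn0Ngt -has_count; apply/hasPn => w _ /=.
by apply/negP => /andP[wb wK]; apply: (forest_disjoint bK wb wK).
Qed.

Section Branch.
Variables (r : seq A) (b : A).
Hypothesis bN : rcons r b \in N.
Let v := rcons r b.

Lemma forest_branch w : forest r [:: b] w = (w == v) || forest v (children v) w.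
Proof.
rewrite forest1 forest_children; case: eqP => [->|]; rewrite ?andbT //.
by rewrite /desc bN prefix_refl.
Qed.

Lemma forest_child_root : forest v (children v) v = false.
Proof. by rewrite forest_children eqxx andbF. Qed.

(** Measured from v instead of r, the level of a vertex and the greatest level
    below it both drop by one, which turns rounding up into rounding down.
    This is why completing a tree from its ceiling half is the same problem,
    one edge further down, as completing it from its floor half. *)
Lemma ceil_branch w : ceil_of r [:: b] w = (w == v) || floor_of v (children v) w.
Proof.
rewrite /ceil_of /floor_of forest_branch; case: eqP => [->|_] /=.
  rewrite /in_ceil /v size_rcons.
  by have := max_level_ge bN (prefix_refl _); rewrite size_rcons => ? /=; lia.
case: (boolP (forest v _ w)) => //= /[dup] /forest_N wN /forest_root[vw];
  rewrite /in_ceil /in_floor /v size_rcons.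
by have := max_level_ge wN (prefix_refl _); move=> ? ?; lia.
Qed.

Lemma count_insert (S : pred (seq A)) : ~~ S v ->
  count (fun w => (w == v) || S w) N = (count S N).+1.
Proof.
move=> Sv; rewrite -[RHS]add1n.
have -> : 1 = count (pred1 v) N by rewrite count_uniq_mem // bN.
rewrite -count_predUI [X in _ = _ + X](_ : _ = 0) ?addn0 //.
apply/eqP; rewrite eqn0Ngt -has_count; apply/hasPn => w _ /=.
by case: eqP => //= ->.
Qed.

Lemma count_forest_branch : count (forest r [:: b]) N = (count (forest v (children v)) N).+1.
Proof. by rewrite (eq_count forest_branch) count_insert // forest_child_root. Qed.

Lemma count_ceil_branch : count (ceil_of r [:: b]) N = (count (floor_of v (children v)) N).+1.
Proof. by rewrite (eq_count ceil_branch) count_insert // /floor_of forest_child_root. Qed.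

Lemma children_N : {in children v, forall a, rcons v a \in N}.
Proof. by move=> a; rewrite mem_children. Qed.

Lemma branch_ceil : (count (ceil_of r [:: b]) N).*2 <= (count (forest r [:: b]) N).+1.
Proof.
rewrite count_forest_branch count_ceil_branch doubleS !ltnS.
have := forest_half (children_uniq v) children_N; apply: leq_trans; exact: leq_addr.
Qed.

Lemma branch_floor : (count (floor_of r [:: b]) N).*2 <= count (forest r [:: b]) N.
Proof.
have bK : {in [:: b], forall c, rcons r c \in N} by move=> c; rewrite inE => /eqP ->.
have := @forest_half r [:: b] isT bK; apply: leq_trans; exact: leq_addr.
Qed.

Lemma branch_floor_ceil :
  count (floor_of r [:: b]) N + count (ceil_of r [:: b]) N <= count (forest r [:: b]) N.
Proof.
have := branch_ceil; have := branch_floor.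
by move: (count (ceil_of _ _) _) (count (floor_of _ _) _) (count (forest _ _) _) => ? ? ?; lia.
Qed.

(** A leaf at even level from r has odd level from v, and would make the
    inequality of forest_half for the tree rooted at v strict. *)
Lemma tight_branch_leaf w :
  (count (ceil_of r [:: b]) N).*2 = (count (forest r [:: b]) N).+1 -> forest r [:: b] w ->
  ~~ odd (size w - size r) -> size w < max_level w.
Proof.
rewrite count_forest_branch count_ceil_branch doubleS =>
  -[tight] /[dup] wnd /forest_root[rw ltrw] ev.
have wN := forest_N wnd; rewrite ltn_neqAle max_level_ge ?prefix_refl // andbT.
apply/eqP => leaf; have := forest_half (children_uniq _) children_N.
rewrite tight leqNgt -addn1 leq_add2l lt0b => /negP; apply.
move: wnd; rewrite forest_branch => /orP[/eqP wv|/forestP[a ach [_ aw]]].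
  by move: ev; rewrite wv /v size_rcons subSn // subnn.
apply/hasP; exists a => //; apply/hasP; exists w => //.
rewrite /desc wN aw -leaf eqxx /= /v size_rcons subnS.
by move: ev ltrw; rewrite -subn_gt0; case: (size w - size r) => //= n; rewrite negbK.
Qed.

End Branch.

(** * Greedy labelling *)

Variables (C : eqType) (colour : cube -> nat -> C) (E0 : cube -> pred nat).
Variables (W : cube -> Prop) (x0 : cube).
Hypothesis colour_sym : forall x i, colour (flip x i) i = colour x i.
Hypothesis E0_proper : proper_at colour E0.
Hypothesis E0_W : forall x i, E0 x i -> W (flip x i).
Implicit Types d : seq A -> nat.
Implicit Types (S Z : pred (seq A)) (E : cube -> pred nat).

Local Notation pos := (pos x0).
Local Notation del_edges := (del_edges colour).

Definition edge_col d w := colour (pos d (parent w)) (d w).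

Definition edges_in E d S := forall w, S w -> E (pos d (parent w)) (d w).
Definition col_inj d S := forall w w', S w -> S w' -> edge_col d w = edge_col d w' -> w = w'.
Definition dir_inj d S := forall w w', S w -> S w' -> d w = d w' -> w = w'.

Definition cols_of d S := [seq edge_col d w | w <- N & S w].
Definition dirs_of d S := [seq d w | w <- N & S w].

Definition below r S := forall w, S w -> [/\ w \in N, prefix r w & size r < size w].

(** Later steps of a construction preserve the properties of the earlier ones
    because they change no label on the paths to the vertices concerned. *)
Definition same_on r d d' S :=
  pos d' r = pos d r /\
  forall w, S w -> [/\ d' w = d w, pos d' (parent w) = pos d (parent w) & pos d' w = pos d w].

Lemma same_off r d d' S Z : anc_closed r S ->
  (forall u, Z u -> size r < size u /\ ~~ S u) -> agree_off Z d d' -> same_on r d d' S.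
Proof.
move=> clS ZP ag.
have offw w u : S w -> prefix u w -> d' u = d u.
  move=> Sw uw; apply: ag; apply/negP => /ZP[ru /negP]; apply.
  exact: clS Sw uw ru.
split.
  apply: pos_agree => u ur; apply: ag; apply/negP => /ZP[ru _].
  by have := leq_trans ru (prefix_leq ur); rewrite ltnn.
move=> w Sw; split.
- by apply: offw Sw _; apply: prefix_refl.
- by apply: pos_agree => u uw; apply: offw Sw (prefix_trans uw (prefix_parent w)).
by apply: pos_agree => u uw; apply: offw Sw uw.
Qed.

Section Same.
Variables (r : seq A) (d d' : seq A -> nat) (S : pred (seq A)).
Hypothesis dd' : same_on r d d' S.

Lemma same_dir w : S w -> d' w = d w. Proof. by case/dd'.2. Qed.
Lemma same_pos w : S w -> pos d' w = pos d w. Proof. by case/dd'.2. Qed.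
Lemma same_root : pos d' r = pos d r. Proof. exact: dd'.1. Qed.
Lemma same_col w : S w -> edge_col d' w = edge_col d w.
Proof. by rewrite /edge_col => /dd'.2[-> -> _]. Qed.
Lemma same_edges E : edges_in E d S -> edges_in E d' S.
Proof. by move=> h w Sw; have [-> -> _] := dd'.2 w Sw; apply: h. Qed.
Lemma same_col_inj : col_inj d S -> col_inj d' S.
Proof. by move=> h w w' Sw Sw'; rewrite !same_col //; apply: h. Qed.
Lemma same_dir_inj : dir_inj d S -> dir_inj d' S.
Proof. by move=> h w w' Sw Sw'; rewrite !same_dir //; apply: h. Qed.

End Same.

Lemma mem_cols_of d S w : w \in N -> S w -> edge_col d w \in cols_of d S.
Proof. by move=> wN Sw; apply: map_f; rewrite mem_filter Sw. Qed.

Lemma mem_dirs_of d S w : w \in N -> S w -> d w \in dirs_of d S.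
Proof. by move=> wN Sw; apply: map_f; rewrite mem_filter Sw. Qed.

Lemma cols_ofP d S k : reflect (exists2 w,
  (w \in N) && S w & k = edge_col d w) (k \in cols_of d S).
Proof.
by apply: (iffP mapP) => -[w wP ->]; exists w => //; move: wP; rewrite mem_filter andbC.
Qed.

Lemma dirs_ofP d S k : reflect (exists2 w, (w \in N) && S w & k = d w) (k \in dirs_of d S).
Proof.
by apply: (iffP mapP) => -[w wP ->]; exists w => //; move: wP; rewrite mem_filter andbC.
Qed.

Lemma size_cols_of d S : size (cols_of d S) = count S N.
Proof. by rewrite size_map size_filter. Qed.

Lemma size_dirs_of d S : size (dirs_of d S) = count S N.
Proof. by rewrite size_map size_filter. Qed.

(** The vertices are added one by one, next to earlier ones. An edge labelled
    before excludes two edges at the parent of the new vertex, by its colour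
    and by its direction, and an entry of X or Y excludes one. The edge from
    the parent towards the root is excluded twice, which saves one. The root
    has no such edge; there, unless the bound leaves room, a non-edge in a
    direction from Y or an edge to an earlier child saves one. *)
Lemma greedy E d r S S' X Y n :
  (forall x i, E x i -> E0 x i) -> W (pos d r) -> (forall x, W x -> deg_ge E x n) ->
  anc_closed r S -> anc_closed r S' -> below r S' -> (forall w, S w -> S' w) ->
  edges_in E d S -> col_inj d S -> dir_inj d S ->
  size X + size Y + (count S' N).*2 <= n.+2 ->
  (forall w, S' w -> ~~ S w -> parent w = r ->
     [\/ size X + size Y + (count S' N).*2 <= n.+1,
         exists2 i, i \in Y & ~~ E (pos d r) i | exists2 v, S v & parent v = r]) ->
  exists d', [/\ agree_off (fun w => S' w && ~~ S w) d d', edges_in E d' S',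
     col_inj d' S', dir_inj d' S' &
     forall w, S' w -> ~~ S w -> edge_col d' w \notin X /\ d' w \notin Y].
Proof.
move=> subE Wr degE clS clS' blS' sub.
have [m] := ubnP (count (fun w => S' w && ~~ S w) N).
elim: m => // m IH in d S Wr clS sub *; rewrite ltnS => cm edS rbS djS bound ov.
have blS : below r S by move=> w /sub /blS'.
case: (boolP (has (fun w => S' w && ~~ S w) N)) => [hasw|]; last first.
  move=> /hasPn nw; exists d.
  have SS' w : S' w -> S w.
    by move=> S'w; have [wN _ _] := blS' w S'w; have := nw w wN; rewrite S'w negbK.
  split=> //.
  - by move=> w /SS'; apply: edS.
  - by move=> w w' /SS' ? /SS'; apply: rbS.
  - by move=> w w' /SS' ? /SS'; apply: djS.
  - by move=> w /SS' ->.
(* a missing word of least size: its parent is labelled already *)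
have [w [wN S'w nSw]] : exists w, [/\ w \in N, S' w && ~~ S w & (parent w == r) || S (parent w)].
  have exk : exists k, has (fun w => [&& S' w, ~~ S w & size w == k]) N.
    by case/hasP: hasw => w wN /andP[S'w nSw]; exists (size w); apply/hasP; exists w;
      rewrite // S'w nSw /=.
  case: (ex_minnP exk) => k /hasP[w wN /and3P[S'w nSw /eqP sw]] kmin.
  exists w; split; rewrite ?S'w //; have [_ rw ltrw] := blS' w S'w.
  have [->//|pr] := eqVneq (parent w) r; apply/negPn/negP => nSp /=.
  have rp : size r < size (parent w).
    rewrite ltn_neqAle size_parent; apply/andP; split; last by lia.
    apply: contra pr => /eqP e; apply/eqP.
    by apply: prefix_size_eq (prefix_parent w) rw _; rewrite size_parent.
  have hasp : has (fun u => [&& S' u, ~~ S u & size u == size (parent w)]) N.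
    apply/hasP; exists (parent w); first exact: Nprefix (prefix_parent w) wN.
    by rewrite (clS' _ _ S'w (prefix_parent w) rp) nSp /=.
  have := kmin _ hasp; rewrite -sw size_parent; have := ltrw; case: (size w) => // q _ /=.
  by rewrite ltnn.
case/andP: S'w => S'w nSw0 in nSw *.
have [_ rw ltrw] := blS' w S'w.
have Wp : W (pos d (parent w)).
  case/orP: nSw => [/eqP ->//|Sp]; have [_ _ ltrp] := blS _ Sp.
  by rewrite (pos_parent x0 d ltrp); apply/E0_W/subE/edS.
pose X1 := X ++ cols_of d S; pose Y1 := Y ++ dirs_of d S.
have cSS' : count S N < count S' N.
  exact: sub_count_lt sub wN S'w nSw0.
have [i /and3P[Ei iX iY]] : exists i, del_edges E X1 Y1 (pos d (parent w)) i.
  have pE : proper_at colour E by apply: proper_sub E0_proper.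
  have sz : size X1 + size Y1 = size X + size Y + (count S N).*2.
    by rewrite !size_cat size_cols_of size_dirs_of -addnn addnACA.
  have le2 : (count S N).*2.+2 <= (count S' N).*2 by rewrite -doubleS leq_double.
  have le : size X1 + size Y1 <= n.
    by rewrite sz -2!ltnS; apply: leq_trans bound; rewrite -2!addnS leq_add2l.
  have ovl j : j \in Y1 -> (E (pos d (parent w)) j -> colour (pos d (parent w)) j \in X1) ->
      exists i, del_edges E X1 Y1 (pos d (parent w)) i.
    exact: free_direction_overlap pE (degE _ Wp) le.
  case/orP: nSw => [/eqP pwr|Sp].
    case: (ov w S'w nSw0 pwr) => [lt|[j jY nEj]|[v Sv pv]].
    - apply: free_direction pE (degE _ Wp) _.
      by rewrite sz -ltnS; apply: leq_trans lt; rewrite -2!addnS leq_add2l.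
    - by apply: (ovl j); rewrite ?pwr ?mem_cat ?jY // (negPf nEj).
    have [vN _ _] := blS v Sv.
    apply: (ovl (d v)); first by rewrite mem_cat mem_dirs_of ?orbT.
    by move=> _; rewrite pwr -pv mem_cat mem_cols_of ?orbT.
  have [pN _ ltrp] := blS _ Sp.
  apply: (ovl (d (parent w))); first by rewrite mem_cat mem_dirs_of ?orbT.
  by move=> _; rewrite (pos_parent x0 d ltrp) colour_sym mem_cat mem_cols_of ?orbT.
move: iX iY; rewrite !mem_cat !negb_or => /andP[iX iXS] /andP[iY iYS].
pose d1 u := if u == w then i else d u.
pose S1 u := (u == w) || S u.
have ag1 : agree_off (pred1 w) d d1 by move=> u; rewrite /= /d1 => /negPf ->.
have sm : same_on r d d1 S.
  by apply: same_off clS _ ag1 => u /eqP ->.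
have d1w : d1 w = i by rewrite /d1 eqxx.
have p1w : pos d1 (parent w) = pos d (parent w).
  case/orP: nSw => [/eqP ->|Sp]; first exact: same_root sm.
  exact: (same_pos sm Sp).
have c1w : edge_col d1 w = colour (pos d (parent w)) i by rewrite /edge_col p1w d1w.
have S1sub u : S1 u -> S' u by case/predU1P=> [->//|]; apply: sub.
have clS1 : anc_closed r S1.
  move=> u x /predU1P[->|Sx] ux ltru; last by rewrite /S1 (clS _ _ Sx) ?orbT.
  have [->|uw] := eqVneq u w; first by rewrite /S1 eqxx.
  have up : prefix u (parent w).
    apply: (prefix_comparable ux (prefix_parent w)); rewrite size_parent.
    have : size u != size w by apply: contra uw => /eqP e;
      apply/eqP/(prefix_size_eq ux (prefix_refl w)).
    by have := prefix_leq ux; move: (size u) (size w) => p q; clear; lia.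
  case/orP: nSw => [/eqP pwr|Sp]; last by rewrite /S1 (clS _ _ Sp) ?orbT.
  by move: (prefix_leq up); rewrite pwr leqNgt ltru.
have [] // := IH d1 S1 _ clS1 S1sub.
- by rewrite (same_root sm).
- apply: leq_trans cm; apply: (@sub_count_lt _ _ _ _ w) => //.
  + by move=> u /andP[S'u]; rewrite /S1 negb_or => /andP[_ ->]; rewrite S'u.
  + by rewrite S'w.
  + by rewrite /S1 eqxx andbF.
- move=> u /predU1P[->|Su]; first by rewrite p1w d1w.
  exact: (same_edges sm edS Su).
- move=> u u' /predU1P[->|Su] /predU1P[->|Su'] //.
  + rewrite c1w (same_col sm Su') => e; have [u'N _ _] := blS u' Su'.
    by case/negP: iXS; rewrite e mem_cols_of.
  + rewrite c1w (same_col sm Su) => e; have [uN _ _] := blS u Su.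
    by case/negP: iXS; rewrite -e mem_cols_of.
  exact: (same_col_inj sm rbS Su Su').
- move=> u u' /predU1P[->|Su] /predU1P[->|Su'] //.
  + rewrite d1w (same_dir sm Su') => e; have [u'N _ _] := blS u' Su'.
    by case/negP: iYS; rewrite e mem_dirs_of.
  + rewrite d1w (same_dir sm Su) => e; have [uN _ _] := blS u Su.
    by case/negP: iYS; rewrite -e mem_dirs_of.
  exact: (same_dir_inj sm djS Su Su').
- move=> u S'u nS1u pu; rewrite (same_root sm).
  move: nS1u; rewrite /S1 negb_or => /andP[_ nSu].
  case: (ov u S'u nSu pu) => [?|?|[v Sv pv]]; [exact: Or31|exact: Or32|apply: Or33].
  by exists v; rewrite // Sv orbT.
move=> d' [ag ed' rb' dj' fresh]; exists d'; split=> //.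
  move=> u nu; rewrite ag; last by apply: contra nu; rewrite /S1 negb_or => /and3P[-> _ ->].
  by apply: ag1; apply: contra nu => /eqP ->; rewrite S'w.
move=> u S'u nSu; have [uw|uw] := eqVneq u w; last first.
  by apply: fresh; rewrite // /S1 negb_or uw.
have sm1 : same_on r d1 d' S1.
  by apply: same_off ag => // x /andP[/blS'[_ _ ltrx] ->].
have S1w : S1 w by rewrite /S1 eqxx.
by rewrite uw (same_col sm1 S1w) (same_dir sm1 S1w) c1w d1w.
Qed.

(** * Completing one branch *)

Definition pos_inj d r S :=
  (forall w, S w -> pos d w <> pos d r) /\
  (forall w w', S w -> S w' -> pos d w = pos d w' -> w = w').

(** A rainbow embedding whose directions are distinct on the ceiling half of
    each branch. As every path from r stays in one branch, it is path-distinct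
    on the ceiling half of the whole forest. *)
Record embeds E d r K : Prop := Embeds {
  embeds_edges : edges_in E d (forest r K);
  embeds_col_inj : col_inj d (forest r K);
  embeds_pos : pos_inj d r (forest r K);
  embeds_ceil : forall b, b \in K -> dir_inj d (ceil_of r [:: b]) }.

(** The floor half is labelled by a doubly distinct homomorphism. *)
Record seeded E d r K : Prop := Seeded {
  seeded_uniq : uniq K;
  seeded_N : {in K, forall b, rcons r b \in N};
  seeded_sub : forall x i, E x i -> E0 x i;
  seeded_root : W (pos d r);
  seeded_edges : edges_in E d (floor_of r K);
  seeded_col_inj : col_inj d (floor_of r K);
  seeded_dir_inj : dir_inj d (floor_of r K) }.

Definition keeps_floor d d' r K := agree_off (fun w => forest r K w && ~~ in_floor r w) d d'.

(** The theorem for the tree formed by r and its branches through K, where z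
    is the direction of the bad neighbour. The graph E varies, because the
    induction deletes colours and directions. *)
Definition completable r K := forall E d z, seeded E d r K ->
  (forall x, W x -> deg_ge E x (count (forest r K) N)) ->
  (forall w, floor_of r K w -> d w <> z) -> ~~ E (pos d r) z ->
  exists d', [/\ keeps_floor d d' r K, embeds E d' r K &
                 forall w, forest r K w -> pos d' w <> flip (pos d' r) z].

Lemma forest_below r K : below r (forest r K).
Proof. by move=> w /[dup] /forest_N wN /forest_root[]. Qed.

Lemma floor_forest r K w : floor_of r K w -> forest r K w. Proof. by case/andP. Qed.
Lemma ceil_forest r K w : ceil_of r K w -> forest r K w. Proof. by case/andP. Qed.

Lemma in_floor_ceil r w : in_floor r w -> in_ceil r w.
Proof. by move=> h; apply: leq_trans h _; rewrite uphalf_half leq_addl. Qed.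

Lemma floor_ceil r K w : floor_of r K w -> ceil_of r K w.
Proof. by case/andP=> wn /in_floor_ceil wc; rewrite /ceil_of wn. Qed.

Lemma floor_closed r K : anc_closed r (floor_of r K).
Proof.
move=> u w /andP[wn wf] uw ru; rewrite /floor_of (forest_closed wn uw ru).
exact: (in_floor_anti uw wf).
Qed.

Lemma ceil_closed r K : anc_closed r (ceil_of r K).
Proof.
move=> u w /andP[wn wf] uw ru; rewrite /ceil_of (forest_closed wn uw ru).
exact: (in_ceil_anti uw wf).
Qed.

Lemma floor_cons r b K w : floor_of r (b :: K) w = floor_of r [:: b] w || floor_of r K w.
Proof. by rewrite /floor_of forest_cons andb_orl. Qed.

Lemma embeds_sub E E' d r K : (forall x i, E x i -> E' x i) -> embeds E d r K -> embeds E' d r K.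
Proof. by move=> sub [ed rb ps cl]; split=> // w /ed /sub. Qed.

Lemma forest_mem r b K w : b \in K -> forest r [:: b] w -> forest r K w.
Proof.
by move=> bK /forestP[c]; rewrite inE => /eqP -> h; apply/forestP; exists b.
Qed.

Lemma embeds_same E d d' r K : same_on r d d' (forest r K) -> embeds E d r K -> embeds E d' r K.
Proof.
move=> sm [ed rb [ps1 ps2] cl]; split.
- exact: (same_edges sm).
- exact: (same_col_inj sm).
- split=> [w wn|w w' wn wn']; first by rewrite (same_pos sm wn) (same_root sm); apply: ps1.
  by rewrite (same_pos sm wn) (same_pos sm wn'); apply: ps2.
move=> b bK w w' wc wc'; rewrite !(same_dir sm) ?(forest_mem bK) ?ceil_forest //.
exact: (cl _ bK).
Qed.

Lemma embeds_cons E d r b K :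
  embeds E d r [:: b] -> embeds E d r K ->
  (forall w w', forest r [:: b] w -> forest r K w' -> edge_col d w <> edge_col d w') ->
  (forall w w', forest r [:: b] w -> forest r K w' -> pos d w <> pos d w') ->
  embeds E d r (b :: K).
Proof.
move=> [edb rbb [ps1b ps2b] clb] [ed rb [ps1 ps2] cl] xcol xpos; split.
- by move=> w; rewrite forest_cons => /orP[/edb|/ed].
- move=> w w'; rewrite !(forest_cons r b K) => /orP[wb|wK] /orP[wb'|wK'].
  + exact: rbb.
  + by move/(xcol _ _ wb wK').
  + by move/esym/(xcol _ _ wb' wK).
  + exact: rb.
- split=> [w|w w']; first by rewrite forest_cons => /orP[/ps1b|/ps1].
  rewrite !(forest_cons r b K) => /orP[wb|wK] /orP[wb'|wK'].
  + exact: ps2b.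
  + by move/(xpos _ _ wb wK').
  + by move/esym/(xpos _ _ wb' wK).
  + exact: ps2.
move=> c; rewrite inE => /predU1P[->|cK]; last exact: cl.
by apply: clb; rewrite inE.
Qed.

Lemma embeds_nil E d r : embeds E d r [::].
Proof.
have no w : forest r [::] w = false by rewrite /forest andbF.
split=> //; first by move=> w; rewrite no.
  by move=> w w'; rewrite no.
by split=> [w|w w']; rewrite no.
Qed.

Section Branch.
Variables (r : seq A) (b : A).
Hypothesis bN : rcons r b \in N.
Local Notation v := (rcons r b).

Lemma ceil_child : ceil_of r [:: b] v.
Proof. by rewrite ceil_branch // eqxx. Qed.

Lemma forest_child : forest r [:: b] v.
Proof. exact: ceil_forest ceil_child. Qed.

(** The tree rooted at v has one edge less than the branch, and its floor half
    is the ceiling half of the branch without v. Deleting the colour of the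
    edge from r to v lowers the degrees by at most one and makes the position
    of r a bad neighbour of v, which the tree rooted at v then avoids. Further
    edges may be deleted in E', as long as the degrees allow it. *)
Lemma branch_complete E E' d :
  completable v (children v) ->
  (forall x i, E x i -> E0 x i) -> (forall x i, E' x i -> E x i) -> W (pos d r) ->
  (forall x i, E' x i -> colour x i <> edge_col d v) ->
  (forall w, ceil_of r [:: b] w -> w <> v -> E' (pos d (parent w)) (d w)) ->
  (forall x, W x -> deg_ge E' x (count (forest r [:: b]) N).-1) ->
  edges_in E d (ceil_of r [:: b]) -> col_inj d (ceil_of r [:: b]) ->
    dir_inj d (ceil_of r [:: b]) ->
  exists d', [/\ agree_off (fun w => forest r [:: b] w && ~~ in_ceil r w) d d',
    embeds E d' r [:: b] &
    forall w, forest r [:: b] w -> w <> v -> E' (pos d' (parent w)) (d' w)].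
Proof.
move=> IH subE subE' Wr colE' edE' degE' ed rb dj.
have cev : ceil_of r [:: b] v by exact: ceil_child.
have pv : pos d v = flip (pos d r) (d v) by apply: pos_rcons.
have flce w : floor_of v (children v) w -> ceil_of r [:: b] w /\ w <> v.
  move=> wf; split; first by rewrite ceil_branch // wf orbT.
  by move=> wv; move: wf; rewrite wv /floor_of forest_child_root.
have [] := IH E' d (d v).
- split.
  + exact: children_uniq.
  + by move=> a; rewrite mem_children.
  + by move=> x i /subE' /subE.
  + by rewrite pv; apply/E0_W/subE; have := ed v cev; rewrite parent_rcons.
  + by move=> w /flce[wc wv]; apply: edE'.
  + by move=> w w' /flce[wc _] /flce[wc' _]; apply: rb.
  + by move=> w w' /flce[wc _] /flce[wc' _]; apply: dj.
- by move=> x Wx; have := degE' x Wx; rewrite count_forest_branch.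
- by move=> w /flce[wc wv] e; apply: wv; apply: dj e.
- by apply/negP => /colE'; apply; rewrite pv colour_sym /edge_col parent_rcons.
move=> d' [comp [ed' rb' [ps1 ps2] _] avz]; exists d'.
have ag : agree_off (fun w => forest r [:: b] w && ~~ in_ceil r w) d d'.
  apply: agree_off_sub comp => w /andP[wn wnf];
    have wr : forest r [:: b] w by rewrite forest_branch // wn orbT.
  rewrite wr; apply: contra wnf => wc; have : ceil_of r [:: b] w by rewrite /ceil_of wr.
  rewrite ceil_branch // => /orP[/eqP wv|/andP[]//].
  by move: wn; rewrite wv forest_child_root.
have sm : same_on r d d' (ceil_of r [:: b]).
  apply: same_off ag; first exact: ceil_closed.
  move=> u /andP[un unc]; have [_ _ ltru] := forest_below un; split=> //.
  by rewrite /ceil_of un.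
have dv' : d' v = d v := same_dir sm cev.
have cv' : edge_col d' v = edge_col d v := same_col sm cev.
have pv' : pos d' v = flip (pos d' r) (d' v) by apply: pos_rcons.
have edw w : forest r [:: b] w -> w <> v -> E' (pos d' (parent w)) (d' w).
  by rewrite forest_branch // => /orP[/eqP//|/ed'].
split=> //; split.
- move=> w wn; have [->|/eqP wv] := eqVneq w v; last exact/subE'/edw.
  exact: (same_edges sm ed cev).
- move=> w w'; rewrite !forest_branch // => /orP[/eqP ->|wn] /orP[/eqP ->|wn'] //.
  + by rewrite cv' => e; case: (colE' _ _ (ed' w' wn')).
  + by rewrite cv' => e; case: (colE' _ _ (ed' w wn)).
  + exact: rb'.
- split=> [w|w w'].
    rewrite forest_branch // => /orP[/eqP ->|wn]; first by rewrite pv'; apply: flip_neq.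
    by have := avz w wn; rewrite pv' dv' flipK.
  rewrite !forest_branch // => /orP[/eqP ->|wn] /orP[/eqP ->|wn'] //.
  + by move=> /esym /(ps1 _ wn').
  + by move=> /(ps1 _ wn).
  + exact: ps2.
by move=> c; rewrite inE => /eqP ->; apply: (same_dir_inj sm).
Qed.

Section Half.
Variables (d : seq A -> nat) (w : seq A).
Hypothesis wn : forest r [:: b] w.
Local Notation l := (size w - size r).

Lemma size_dir_seq : size (dir_seq d r w) = l.
Proof. by rewrite size_map size_lineage. Qed.

Lemma branch_depth : l <= max_level w - size r.
Proof. by apply: leq_sub2r; apply: max_level_ge (forest_N wn) (prefix_refl w). Qed.

Lemma take_ceil k u : k <= uphalf (max_level w - size r) ->
  u \in take k (lineage r w) -> ceil_of r [:: b] u.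
Proof.
move=> kl; have [rw ltrw] := forest_root wn.
rewrite mem_take_lineage ?(ltnW ltrw) // => /and3P[uw ltru uk].
rewrite /ceil_of (forest_closed wn uw ltru) /in_ceil.
apply: leq_trans (_ : k <= _); first by rewrite leq_subLR.
by apply: leq_trans kl _; apply/uphalf_leq/leq_sub2r/max_level_anti.
Qed.

Lemma take_floor k u : k <= (max_level w - size r)./2 ->
  u \in take k (lineage r w) -> floor_of r [:: b] u.
Proof.
move=> kl; have [rw ltrw] := forest_root wn.
rewrite mem_take_lineage ?(ltnW ltrw) // => /and3P[uw ltru uk].
rewrite /floor_of (forest_closed wn uw ltru) /in_floor.
apply: leq_trans (_ : k <= _); first by rewrite leq_subLR.
by apply: leq_trans kl _; apply/half_leq/leq_sub2r/max_level_anti.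
Qed.

Hypothesis dj : dir_inj d (ceil_of r [:: b]).

Lemma take_dir_seq_uniq k : k <= uphalf (max_level w - size r) -> uniq (take k (dir_seq d r w)).
Proof.
move=> kl; rewrite -map_take map_inj_in_uniq ?take_uniq ?lineage_uniq //.
by move=> u u' /(take_ceil kl) uc /(take_ceil kl) uc'; apply: dj.
Qed.

(** If w were placed there, every direction in the sequence formed by z and
    the path to w would occur evenly often; but z and the first half of that
    path, rounded up, are distinct and more than half of the sequence. *)
Lemma branch_avoid z : (forall u, ceil_of r [:: b] u -> d u <> z) ->
  pos d w <> flip (pos d r) z.
Proof.
have [rw _] := forest_root wn; move=> nz /(pos_flipP _ _ _ rw) odd_z.
set p := dir_seq d r w in odd_z; pose k := uphalf l.
have kl : k <= uphalf (max_level w - size r) by apply/uphalf_leq/branch_depth.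
have sp : size p = l := size_dir_seq.
have zu : z \notin take k p.
  by rewrite -map_take; apply/mapP => -[u /(take_ceil kl) uc /esym]; apply: nz.
have := @uniq_even_size _ (z :: take k p) (z :: p).
rewrite /= zu take_dir_seq_uniq // size_takel ?sp; last by rewrite /k leq_uphalf_double; lia.
move=> /(_ isT) h; have : k.+1.*2 <= l.+1.
  apply: h.
  - by move=> i; rewrite !inE => /orP[->//|/mem_take ->]; rewrite orbT.
  - by move=> i _; rewrite oddD odd_z eq_sym oddb addbb.
by rewrite /k; move: (l) => m; clear; lia.
Qed.

(** The directions of the floor half are missing on the path to w', so they
    occur evenly often on the path to w, whose second half they exhaust up to
    one entry. *)
Lemma branch_collision w' : prefix r w' -> pos d w = pos d w' ->
  (forall u, floor_of r [:: b] u -> d u \notin dir_seq d r w') ->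
  pos d w = pos d r \/ exists2 u, ceil_of r [:: b] u & pos d w = flip (pos d r) (d u).
Proof.
have [rw _] := forest_root wn; move=> rw' eqp nfl.
have kl : uphalf l <= uphalf (max_level w - size r) by apply/uphalf_leq/branch_depth.
have [||ev|[i]] := @parity_of_half _ (dir_seq d r w); rewrite ?size_dir_seq.
- exact: take_dir_seq_uniq.
- move=> i; rewrite -map_take => /mapP[u uP ->].
  rewrite (pos_eq_parity rw rw' eqp); have := nfl u (take_floor _ uP).
  rewrite -has_pred1 has_count -eqn0Ngt => /(_ _)/eqP -> //.
  by apply/half_leq/branch_depth.
- by left; apply/(pos_evenP _ _ rw).
rewrite -map_take => /mapP[u /(take_ceil kl) uc ->] /(pos_flipP _ _ _ rw).
by right; exists u.
Qed.

(** The direction of v occurs once on the path to w, so it is the only one to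
    occur oddly often, and w is at the position of v. *)
Lemma branch_adjacent i : pos_inj d r (forest r [:: b]) ->
  (forall u, forest r [:: b] u -> u <> v -> d u <> d v) ->
  pos d w = flip (pos d r) i -> w = v.
Proof.
move=> [_ pinj] dv eqw; apply: pinj => //; first exact: forest_child.
have vw : prefix v w by move: wn; rewrite forest1 => /andP[].
have pv : pos d v = flip (pos d r) (d v) by apply: pos_rcons.
rewrite eqw pv; congr flip; apply/eqP.
have : pos d w (d v) = pos d v (d v).
  rewrite (pos_rel x0 d (d v) vw) (count_memPn _) ?addbF //.
  apply/mapP => -[u]; rewrite mem_lineage ?prefix_leq // => /andP[uw ltvu] e.
  apply: (dv u) (esym e); last by move=> uv; move: ltvu; rewrite uv ltnn.
  apply: (forest_closed wn uw); apply: leq_trans ltvu; by rewrite size_rcons ltnS leqnSn.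
by rewrite eqw pv /flip eqxx eq_sym => /addbI ->.
Qed.

End Half.
End Branch.

(** * Adding a branch to a completed forest *)

Lemma anc_closed_or r S S' : anc_closed r S -> anc_closed r S' ->
  anc_closed r (fun w => S w || S' w).
Proof.
move=> cl cl' u w /orP[Sw|Sw] uw ltru; first by rewrite (cl u w).
by rewrite (cl' u w) ?orbT.
Qed.

Lemma below_or r S S' : below r S -> below r S' -> below r (fun w => S w || S' w).
Proof. by move=> bl bl' w /orP[/bl|/bl']. Qed.

Lemma ceil_below r K : below r (ceil_of r K).
Proof. by move=> w /ceil_forest /forest_below. Qed.

Lemma edges_del E d S X Y : edges_in E d S ->
  (forall w, S w -> edge_col d w \notin X) -> (forall w, S w -> d w \notin Y) ->
  edges_in (del_edges E X Y) d S.
Proof. by move=> ed nX nY w Sw; rewrite /del_edges ed //= nX // nY. Qed.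

Lemma root_off r d d' Z : (forall u, Z u -> size r < size u) -> agree_off Z d d' ->
  pos d' r = pos d r.
Proof.
move=> Zr ag; apply: pos_agree => u ur; apply: ag; apply/negP => /Zr.
by rewrite ltnNge prefix_leq.
Qed.

Lemma same_disjoint r d d' S Z : anc_closed r S -> below r Z ->
  (forall u, Z u -> S u -> False) -> agree_off Z d d' -> same_on r d d' S.
Proof.
move=> cl blZ dis; apply: same_off => // u uZ; have [_ _ ltru] := blZ u uZ.
by split=> //; apply/negP; apply: dis.
Qed.

(** Here d labels the ceiling half of the branch and d' completes the forest
    K. The branch is completed without the colours of K. When Y consists of
    the direction of v, the vertices of the branch other than v are moreover
    kept away from the neighbours of the root, by branch_adjacent. *)
Lemma add_branch E d d' r b K Y :
  let v := rcons r b in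
  b \notin K -> rcons r b \in N -> completable v (children v) ->
  (forall x i, E x i -> E0 x i) -> W (pos d r) ->
  edges_in E d (ceil_of r [:: b]) -> col_inj d (ceil_of r [:: b]) ->
    dir_inj d (ceil_of r [:: b]) ->
  agree_off (forest r K) d d' -> embeds E d' r K ->
  (forall w u, forest r K w -> ceil_of r [:: b] u -> edge_col d' w <> edge_col d u) ->
  (forall i, i \in Y -> i = d v) ->
  (forall x, W x ->
     deg_ge (del_edges E (edge_col d v :: cols_of d' (forest r K)) Y) x (count (forest r [:: b]) N).-1) ->
  exists d'', [/\ agree_off (fun w => forest r [:: b] w && ~~ in_ceil r w) d' d'',
    embeds E d'' r [:: b], embeds E d'' r K,
    forall w w', forest r [:: b] w -> forest r K w' -> edge_col d'' w <> edge_col d'' w' &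
    forall w, forest r [:: b] w -> w <> v -> d'' w \notin Y].
Proof.
move=> v bK bN IH subE Wr ed rb dj ag gd xcol Yv degE.
have cev : ceil_of r [:: b] v by exact: ceil_child.
have sm : same_on r d d' (ceil_of r [:: b]).
  apply: same_disjoint ag; [exact: ceil_closed|exact: forest_below|].
  by move=> u un /ceil_forest ub; apply: (forest_disjoint bK ub un).
pose E2 := del_edges E (cols_of d' (forest r K)) [::].
pose E2' := del_edges E (edge_col d v :: cols_of d' (forest r K)) Y.
have nK w : ceil_of r [:: b] w -> edge_col d w \notin cols_of d' (forest r K).
  move=> wc; apply/cols_ofP => -[u /andP[_ un] e].
  exact: (xcol _ _ un wc (esym e)).
have edE2 : edges_in E2 d' (ceil_of r [:: b]).
  apply: edges_del => //; first exact: (same_edges sm ed).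
  by move=> w wc; rewrite (same_col sm wc) nK.
have [|||||||||d'' [ag' gd' edY]] := @branch_complete r b bN E2 E2' d' IH.
- by move=> x i /del_sub /subE.
- by rewrite /E2 /E2' => x i /and3P[Ei]; rewrite inE negb_or => /andP[_ nX] _;
  rewrite /del_edges Ei nX.
- by rewrite (same_root sm).
- move=> x i /and3P[_]; rewrite inE negb_or => /andP[/eqP ne _] _.
  by rewrite (same_col sm cev).
- move=> w wc wv; have [Ei nX _] := and3P (edE2 w wc).
  rewrite /E2' /del_edges Ei inE negb_or nX andbT /=.
  apply/andP; split.
    apply/eqP => e; apply: wv; apply: rb => //.
    by rewrite -(same_col sm wc).
  by apply/negP => /Yv; rewrite (same_dir sm wc) => e; apply: wv; apply: dj.
- exact: degE.
- exact: edE2.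
- exact: (same_col_inj sm).
- exact: (same_dir_inj sm).
have smK : same_on r d' d'' (forest r K).
  apply: same_disjoint ag'; [exact: forest_closed|by move=> u /andP[/forest_below]|].
  by move=> u /andP[un _]; apply: (forest_disjoint bK un).
exists d''; split=> //.
- by apply: embeds_sub gd' => x i /del_sub.
- exact: (embeds_same smK).
- move=> w w' wn wn' e; have /and3P[_ /negP nX _] := embeds_edges gd' wn.
  apply: nX; rewrite -/(edge_col d'' w) e (same_col smK wn').
  by apply: mem_cols_of => //; apply: (forest_N wn').
by move=> w wn wv; have /and3P[_ _] := edY w wn wv.
Qed.

Definition adjacent_children d r S := forall w i, S w -> pos d w = flip (pos d r) i ->
  parent w = r.

(** The point where w and w' meet is not the position of r, which the branch
    meets only in r. *)
Lemma branch_apart d r b K w w' :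
  pos_inj d r (forest r [:: b]) -> dir_inj d (ceil_of r [:: b]) ->
  (forall u u', floor_of r [:: b] u -> forest r K u' -> d u <> d u') ->
  forest r [:: b] w -> forest r K w' -> pos d w = pos d w' ->
  exists2 u, ceil_of r [:: b] u & pos d w' = flip (pos d r) (d u).
Proof.
move=> ps dj fK wn wn' eqp; have [rw' ltrw'] := forest_root wn'.
have [|/(ps.1 _ wn) []|[u uc e]] := branch_collision wn dj rw' eqp.
  move=> u uf; apply/mapP => -[u' uP]; apply: fK => //.
  move: uP; rewrite mem_lineage ?prefix_leq // => /andP[uw' ltru].
  exact: (forest_closed wn' uw' ltru).
by exists u; rewrite // -eqp.
Qed.

Lemma child_pos d r w : parent w = r -> size r < size w -> pos d w = flip (pos d r) (d w).
Proof. by move=> <-; apply: pos_parent. Qed.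

(** The two vertices would meet next to the root, so both would be children of
    the root, reached by the same edge and therefore by the same colour. *)
Lemma slack_apart d r b K :
  let v := rcons r b in rcons r b \in N ->
  pos_inj d r (forest r [:: b]) -> dir_inj d (ceil_of r [:: b]) ->
  (forall w, forest r [:: b] w -> w <> v -> d w <> d v) ->
  adjacent_children d r (forest r K) ->
  (forall u u', floor_of r [:: b] u -> forest r K u' -> d u <> d u') ->
  (forall w w', forest r [:: b] w -> forest r K w' -> edge_col d w <> edge_col d w') ->
  forall w w', forest r [:: b] w -> forest r K w' -> pos d w <> pos d w'.
Proof.
move=> v bN ps dj dv adj fK xcol w w' wn wn' eqp.
have [u uc e] := branch_apart ps dj fK wn wn' eqp.
have wv : w = v := branch_adjacent bN wn ps dv (etrans eqp e).
have [_ ltrw'] := forest_root wn'; have pw' := adj _ _ wn' e.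
have pv : parent v = r by rewrite parent_rcons.
apply: (xcol w w') => //; rewrite wv /edge_col pw' pv; congr colour.
apply: (@flip_inj (pos d r)); rewrite -(child_pos d pw' ltrw') -eqp wv.
by rewrite (child_pos d pv) // size_rcons.
Qed.

(** More than half of the directions on the path to w belong to the ceiling
    half, by rounding if the level of w is odd, and because w has a deeper
    descendant if it is even. On the path to w' at least half of them do. *)
Lemma tight_apart d r b b' w w' :
  b \notin [:: b'] -> dir_inj d (fun u => ceil_of r [:: b] u || ceil_of r [:: b'] u) ->
  (~~ odd (size w - size r) -> size w < max_level w) ->
  forest r [:: b] w -> forest r [:: b'] w' -> pos d w <> pos d w'.
Proof.
move=> bb' dj leaf wn wn' eqp.
have [rw ltrw] := forest_root wn; have [rw' ltrw'] := forest_root wn'.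
set l := size w - size r in leaf; set l' := size w' - size r.
set k := (l./2).+1; set k' := uphalf l'.
have l_gt0 : 0 < l by rewrite subn_gt0.
have kl : k <= uphalf (max_level w - size r).
  have := branch_depth wn; rewrite -/l leq_eqVlt => /predU1P[lE|lt]; last first.
    by apply: leq_trans (uphalf_leq lt); rewrite /k uphalfE ltnS.
  rewrite -lE /k; case: (boolP (odd l)) => [ol|/leaf ltl]; first by rewrite uphalf_half ol.
  by move: lE; rewrite /l => e; have := ltn_sub2r (leq_trans ltrw (ltnW ltl)) ltl; rewrite e ltnn.
have kl' : k' <= uphalf (max_level w' - size r) by exact: (uphalf_leq (branch_depth wn')).
have djb : dir_inj d (ceil_of r [:: b]) by move=> u u' uc uc'; apply: dj; rewrite /= ?uc ?uc'.
have djb' : dir_inj d (ceil_of r [:: b']) by move=> u u' uc uc'; apply: dj; apply/orP; right.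
have := @uniq_even_size _ (take k (dir_seq d r w) ++
  take k' (dir_seq d r w')) (dir_seq d r w ++ dir_seq d r w').
rewrite cat_uniq (take_dir_seq_uniq wn) // (take_dir_seq_uniq wn') // andbT /=.
rewrite !size_cat !size_takel ?size_dir_seq; first last.
- by rewrite -/l /k; move: (l) l_gt0 => m; clear; lia.
- by rewrite -/l' /k'; move: (l') => m; clear; lia.
move=> h; suff : (k + k').*2 <= l + l' by rewrite /k /k'; move: (l) (l') => m m'; clear; lia.
apply: h.
- apply/hasPn => i; rewrite -map_take => /mapP[u' /(take_ceil wn' kl') uc' ->].
  rewrite -map_take; apply/mapP => -[u /(take_ceil wn kl) uc e].
  have uu : u' = u by apply: dj; rewrite /= ?uc ?uc' ?orbT.
  by apply: (forest_disjoint bb' (ceil_forest uc)); rewrite -uu ceil_forest.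
- by move=> i; rewrite !mem_cat => /orP[/mem_take ->//|/mem_take ->]; rewrite orbT.
by move=> i _; rewrite count_cat oddD (pos_eq_parity rw rw' eqp) addbb.
Qed.

(** * Completing a forest *)

Ltac count_lia := clear; repeat (match goal with |- context [count ?P ?s] =>
  generalize (count P s) end); intros; lia.

Lemma floor_half_count r K : uniq K -> {in K, forall b, rcons r b \in N} ->
  (count (floor_of r K) N).*2 <= count (forest r K) N.
Proof. by move=> UK KN; have := forest_half UK KN; apply: leq_trans; apply: leq_addr. Qed.

Lemma keeps_floor_cons r b K d d1 d2 d3 S' :
  (forall w, S' w -> forest r (b :: K) w) ->
  agree_off (fun w => S' w && ~~ floor_of r (b :: K) w) d d1 ->
  agree_off (fun w => forest r K w && ~~ in_floor r w) d1 d2 ->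
  agree_off (fun w => forest r [:: b] w && ~~ in_ceil r w) d2 d3 ->
  keeps_floor d d3 r (b :: K).
Proof.
move=> S'nd ag1 ag2 ag3.
apply: (@agree_off_trans _ _ d d2); first apply: (@agree_off_trans _ _ d d1).
- apply: agree_off_sub ag1 => w /andP[/S'nd wn]; by rewrite /floor_of wn.
- by apply: agree_off_sub ag2 => w /andP[wn wf]; rewrite (forest_cons r b K) wn orbT.
apply: agree_off_sub ag3 => w /andP[wn wf]; rewrite (forest_cons r b K) wn.
by rewrite /=; apply: contra wf; apply: in_floor_ceil.
Qed.

(** The first step of every construction: the ceiling half of one branch and
    the floor halves of the others have few enough edges to be labelled doubly
    distinctly, with one direction to spare. *)
Lemma open_branch E d r b K Y :
  let S' := fun w => ceil_of r [:: b] w || floor_of r K w in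
  seeded E d r (b :: K) -> (forall x, W x -> deg_ge E x (count (forest r (b :: K)) N)) ->
  size Y <= 1 -> (forall w, floor_of r (b :: K) w -> d w \notin Y) ->
  {in Y, forall z, ~~ E (pos d r) z} ->
  exists d1, [/\ agree_off (fun w => S' w && ~~ floor_of r (b :: K) w) d d1,
    edges_in E d1 S', col_inj d1 S', dir_inj d1 S' & forall w, S' w -> d1 w \notin Y].
Proof.
move=> S' [UbK KN subE Wr ed rb dj] degE Y1 nY nE; have /andP[bK UK] := UbK.
have bN : rcons r b \in N by apply: KN; rewrite inE eqxx.
have KN' : {in K, forall c, rcons r c \in N} by move=> c cK; apply: KN; rewrite inE cK orbT.
have cn := count_forest_cons r bK.
have S'nd w : S' w -> forest r (b :: K) w.
  by rewrite (forest_cons r b K) => /orP[/ceil_forest ->//|/floor_forest ->]; rewrite orbT.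
have clS' : anc_closed r S' by apply: anc_closed_or; [exact: ceil_closed|exact: floor_closed].
have clS : anc_closed r (floor_of r (b :: K)) by exact: floor_closed.
have c2 : (count S' N).*2 <= (count (forest r (b :: K)) N).+1.
  have := count_or_leq (ceil_of r [:: b]) (floor_of r K) N;
    rewrite -leq_double doubleD => /leq_trans; apply.
  by rewrite cn -addSn leq_add ?branch_ceil // floor_half_count.
have [|||||||||d1 [ag1 ed1 rb1 dj1 fr1]] :=
  @greedy E d r (floor_of r (b :: K)) S' [::] Y _ subE Wr degE.
- exact: clS.
- exact: clS'.
- by move=> w /S'nd /forest_below.
- by move=> w; rewrite floor_cons /S' => /orP[/floor_ceil ->|->]; rewrite ?orbT.
- exact: ed.
- exact: rb.
- exact: dj.
- by rewrite /= add0n; apply: leq_trans (leq_add Y1 c2) _.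
- move=> w _ _ _; case: Y nE {Y1 nY} => [|z Y] nE; first by apply: Or31; rewrite /= !add0n.
  by apply: Or32; exists z; [|apply: nE]; rewrite inE eqxx.
exists d1; split=> // w S'w; case: (boolP (floor_of r (b :: K) w)) => [wf|nwf].
  by rewrite ag1 ?nY // wf andbF.
by have [] := fr1 w S'w nwf.
Qed.

(** One spare edge at each vertex allows completing every branch in a graph
    without the direction of its first edge, and then only that edge leads to
    a neighbour of the root. At the root no spare edge is asked for, because
    there the colour and the direction of the first edge exclude the same
    edge. Vertices in different branches are apart by slack_apart. *)
Lemma complete_with_slack r K E d :
  seeded E d r K -> {in K, forall b, completable (rcons r b) (children (rcons r b))} ->
  (forall x, W x -> x <> pos d r -> deg_ge E x (count (forest r K) N).+1) ->
  deg_ge E (pos d r) (count (forest r K) N) ->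
  exists d', [/\ keeps_floor d d' r K, embeds E d' r K & adjacent_children d' r (forest r K)].
Proof.
elim: K E d => [|b K IHK] E d st IH degE degr.
  exists d; split; [by []|exact: embeds_nil|by move=> w i; rewrite /forest andbF].
have [UbK KN subE Wr ed rb dj] := st; have /andP[bK UK] := UbK.
have bN : rcons r b \in N by apply: KN; rewrite inE eqxx.
have KN' : {in K, forall c, rcons r c \in N} by move=> c cK; apply: KN; rewrite inE cK orbT.
have pE : proper_at colour E := proper_sub subE E0_proper.
have cn := count_forest_cons r bK; set v := rcons r b.
pose S' w := ceil_of r [:: b] w || floor_of r K w.
have S'nd w : S' w -> forest r (b :: K) w.
  by rewrite (forest_cons r b K) => /orP[/ceil_forest ->//|/floor_forest ->]; rewrite orbT.
have degn x : W x -> deg_ge E x (count (forest r (b :: K)) N).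
  by move=> Wx; have [->//|/eqP/(degE x Wx)] := eqVneq x (pos d r); apply: deg_leq.
have [//|//|//|d1 [ag1 ed1 rb1 dj1 _]] := @open_branch E d r b K [::] st degn.
have r1 : pos d1 r = pos d r.
  by apply: root_off ag1 => u /andP[/S'nd/forest_below[]].
have ceS' w : ceil_of r [:: b] w -> S' w by rewrite /S' => ->.
have flS' w : floor_of r K w -> S' w by rewrite /S' orbC => ->.
have flbS' w : floor_of r [:: b] w -> S' w by move=> /floor_ceil /ceS'.
have disj w w' : forest r [:: b] w -> forest r K w' -> w <> w'.
  by move=> wn wn' e; apply: (forest_disjoint bK wn); rewrite e.
pose E1 := del_edges E (cols_of d1 (ceil_of r [:: b])) (dirs_of d1 (floor_of r [:: b])).
have ncol w u : S' w -> forest r K w -> ceil_of r [:: b] u -> edge_col d1 w <> edge_col d1 u.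
  by move=> Sw wn uc e; apply: (disj u w) => //; [exact: ceil_forest|exact/esym/rb1/e/ceS'].
have ndir w u : S' w -> forest r K w -> floor_of r [:: b] u -> d1 w <> d1 u.
  by move=> Sw wn uf e; apply: (disj u w) => //; [exact: floor_forest|exact/esym/dj1/e/flbS'].
have [||||d2 [ag2 gd2 adj2]] := IHK E1 d1.
- split=> //.
  + by move=> x i /del_sub /subE.
  + by rewrite r1.
  + apply: edges_del; first by move=> w /flS' /ed1.
      move=> w wf; apply/cols_ofP => -[u /andP[_ uc]].
      by apply: ncol => //; [exact: flS'|exact: floor_forest].
    move=> w wf; apply/dirs_ofP => -[u /andP[_ uc]].
    by apply: ndir => //; [exact: flS'|exact: floor_forest].
  + by move=> w w' wf wf'; apply: rb1; apply: flS'.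
  + by move=> w w' wf wf'; apply: dj1; apply: flS'.
- by move=> c cK; apply: IH; rewrite inE cK orbT.
- move=> x Wx xr; rewrite r1 in xr; apply: (deg_del pE (degE x Wx xr)).
  rewrite size_cols_of size_dirs_of cn; have := branch_floor_ceil bN; count_lia.
- rewrite r1; apply: (deg_del pE degr).
  rewrite size_cols_of size_dirs_of cn; have := branch_floor_ceil bN; count_lia.
have sub1 x i : E1 x i -> E x i by apply: del_sub.
have K2 w : forest r K w -> edge_col d2 w \notin cols_of d1 (ceil_of r [:: b]) /\ d2 w \notin dirs_of d1 (floor_of r [:: b]).
  by move=> wn; have /and3P[_ ? ?] := embeds_edges gd2 wn.
have sm2 : same_on r d1 d2 (ceil_of r [:: b]).
  apply: same_disjoint ag2; [exact: ceil_closed| |].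
    by move=> u /andP[/forest_below].
  by move=> u /andP[un _] /ceil_forest ub; apply: (disj u u).
have edc : edges_in E d1 (ceil_of r [:: b]) by move=> w /ceS'/ed1.
have [|||||||||||d3 [ag3 gd3 gdK3 xcol av3]] := @add_branch E d1 d2 r b K [:: d1 v] bK bN.
- by apply: IH; rewrite inE eqxx.
- exact: subE.
- by rewrite r1.
- exact: edc.
- by move=> w w' /ceS' wS /ceS'; apply: rb1.
- by move=> w w' /ceS' wS /ceS'; apply: dj1.
- by apply: agree_off_sub ag2 => w /andP[].
- exact: embeds_sub sub1 gd2.
- move=> w u wn uc e; have [/negP nX _] := K2 w wn; apply: nX.
  by rewrite e mem_cols_of // (forest_N (ceil_forest uc)).
- by move=> i; rewrite inE => /eqP.
- move=> x Wx; have [xr|xr] := eqVneq x (pos d r).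
    apply: (@deg_mono (del_edges E (edge_col d1 v :: cols_of d2 (forest r K)) [::])).
      move=> i /and3P[Ei nX _]; rewrite /del_edges Ei nX inE.
      apply: contra nX => /eqP ->; rewrite xr -r1.
      have <- : parent v = r by apply: parent_rcons.
      by rewrite inE eqxx.
    rewrite xr; apply: (deg_del pE degr) => /=.
    rewrite size_cols_of cn; have : 0 < count (forest r [:: b]) N by rewrite count_forest_branch.
    count_lia.
  apply: (deg_del pE (degE x Wx (elimN eqP xr))) => /=.
  rewrite size_cols_of cn; have : 0 < count (forest r [:: b]) N by rewrite count_forest_branch.
  count_lia.
have sm3 : same_on r d2 d3 (forest r K).
  apply: same_disjoint ag3; [exact: forest_closed| |].
    by move=> u /andP[/forest_below].
  by move=> u /andP[ub _] un; apply: (disj u u).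
have smc3 : same_on r d2 d3 (ceil_of r [:: b]).
  apply: same_disjoint ag3; [exact: ceil_closed| |].
    by move=> u /andP[/forest_below].
  by move=> u /andP[_ /negP nc] /andP[_ /nc].
have d3d1 w : ceil_of r [:: b] w -> d3 w = d1 w by move=> wc;
  rewrite (same_dir smc3) // (same_dir sm2).
have adj3 : adjacent_children d3 r (forest r K).
  move=> w i wn; rewrite (same_pos sm3) // (same_root sm3); exact: adj2.
have dv3 w : forest r [:: b] w -> w <> v -> d3 w <> d3 v.
  by move=> wn wv; have := av3 w wn wv; rewrite inE => /eqP; rewrite (d3d1 v) //;
    apply: ceil_child.
have djb3 : dir_inj d3 (ceil_of r [:: b]) by apply: (embeds_ceil gd3); rewrite inE.
have psb3 := embeds_pos gd3.
exists d3; split.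
- exact: keeps_floor_cons S'nd ag1 ag2 ag3.
- apply: embeds_cons => //; apply: (slack_apart bN psb3 djb3 dv3 adj3) => //.
  move=> u u' uf un; rewrite (same_dir sm3 un) (d3d1 u (floor_ceil uf)) => e.
  have [_ /negP] := K2 u' un; apply; rewrite -e mem_dirs_of //.
  exact: forest_N (floor_forest uf).
move=> w i; rewrite (forest_cons r b K) => /orP[wn|]; last exact: adj3.
move=> /(branch_adjacent bN wn psb3 dv3) ->; exact: parent_rcons.
Qed.

(** If the ceiling half has at most half of the edges of the branch, the
    degree suffices to complete K in a graph without its colours and without
    its directions. By branch_collision, a vertex of the branch can meet a
    vertex of K only if the path to the latter has one of these directions. *)
Lemma completable_loose r b K :
  K = [::] \/ (count (ceil_of r [:: b]) N).*2 <= count (forest r [:: b]) N ->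
  completable (rcons r b) (children (rcons r b)) -> completable r K -> completable r (b :: K).
Proof.
move=> loose IHb IHK E d z st degE dz nEz.
have [|w wf|i|d1 [ag1 ed1 rb1 dj1 nz]] := @open_branch E d r _ _ [:: z] st degE.
- by [].
- by rewrite inE; apply/eqP/dz.
- by rewrite inE => /eqP ->.
have {nz}nz1 w : ceil_of r [:: b] w || floor_of r K w -> d1 w <> z.
  by move/nz; rewrite inE => /eqP.
have [UbK KN subE Wr ed rb dj] := st; have /andP[bK UK] := UbK.
have bN : rcons r b \in N by apply: KN; rewrite inE eqxx.
have KN' : {in K, forall c, rcons r c \in N} by move=> c cK; apply: KN; rewrite inE cK orbT.
have pE : proper_at colour E := proper_sub subE E0_proper.
have cn := count_forest_cons r bK; set v := rcons r b.
pose S' w := ceil_of r [:: b] w || floor_of r K w.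
have S'nd w : S' w -> forest r (b :: K) w.
  by rewrite (forest_cons r b K) => /orP[/ceil_forest ->//|/floor_forest ->]; rewrite orbT.
have r1 : pos d1 r = pos d r.
  by apply: root_off ag1 => u /andP[/S'nd/forest_below[]].
have ceS' w : ceil_of r [:: b] w -> S' w by rewrite /S' => ->.
have flS' w : floor_of r K w -> S' w by rewrite /S' orbC => ->.
have disj w w' : forest r [:: b] w -> forest r K w' -> w <> w'.
  by move=> wn wn' e; apply: (forest_disjoint bK wn); rewrite e.
pose E1 := del_edges E (cols_of d1 (ceil_of r [:: b])) (dirs_of d1 (ceil_of r [:: b])).
have [||||d2 [ag2 gd2 avz2]] := IHK E1 d1 z.
- split=> //.
  + by move=> x i /del_sub /subE.
  + by rewrite r1.
  + apply: edges_del; first by move=> w /flS' /ed1.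
      move=> w wf; apply/cols_ofP => -[u /andP[_ uc] e].
      by apply: (disj u w); [exact: ceil_forest|exact: floor_forest|exact/esym/rb1/e/ceS'/uc/flS'].
    move=> w wf; apply/dirs_ofP => -[u /andP[_ uc] e].
    by apply: (disj u w); [exact: ceil_forest|exact: floor_forest|exact/esym/dj1/e/ceS'/uc/flS'].
  + by move=> w w' wf wf'; apply: rb1; apply: flS'.
  + by move=> w w' wf wf'; apply: dj1; apply: flS'.
- move=> x Wx; case: loose => [->|loose].
    by exists [::]; split=> //; rewrite (eq_count (_ : _ =1 pred0)) ?count_pred0 // => w;
      rewrite /forest andbF.
  apply: (deg_del pE (degE x Wx)); rewrite size_cols_of size_dirs_of cn; move: loose; count_lia.
- by move=> w /flS'/nz1.
- by apply: contra nEz => /del_sub; rewrite r1.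
have sub1 x i : E1 x i -> E x i by apply: del_sub.
have K2 w : forest r K w -> edge_col d2 w \notin cols_of d1 (ceil_of r [:: b]) /\ d2 w \notin dirs_of d1 (ceil_of r [:: b]).
  by move=> wn; have /and3P[_ ? ?] := embeds_edges gd2 wn.
have sm2 : same_on r d1 d2 (ceil_of r [:: b]).
  apply: same_disjoint ag2; [exact: ceil_closed| |].
    by move=> u /andP[/forest_below].
  by move=> u /andP[un _] /ceil_forest ub; apply: (disj u u).
have edc : edges_in E d1 (ceil_of r [:: b]) by move=> w /ceS'/ed1.
have [||||||||||d3 [ag3 gd3 gdK3 xcol av3]] := @add_branch E d1 d2 r b K [::] bK bN IHb.
- exact: subE.
- by rewrite r1.
- exact: edc.
- by move=> w w' /ceS' wS /ceS'; apply: rb1.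
- by move=> w w' /ceS' wS /ceS'; apply: dj1.
- by apply: agree_off_sub ag2 => w /andP[].
- exact: embeds_sub sub1 gd2.
- move=> w u wn uc e; have [/negP nX _] := K2 w wn; apply: nX.
  by rewrite e mem_cols_of // (forest_N (ceil_forest uc)).
- by [].
- move=> x Wx; apply: (deg_del pE (degE x Wx)) => /=.
  rewrite size_cols_of cn; have : 0 < count (forest r [:: b]) N by rewrite count_forest_branch.
  count_lia.
have sm3 : same_on r d2 d3 (forest r K).
  apply: same_disjoint ag3; [exact: forest_closed| |].
    by move=> u /andP[/forest_below].
  by move=> u /andP[ub _] un; apply: (disj u u).
have smc3 : same_on r d2 d3 (ceil_of r [:: b]).
  apply: same_disjoint ag3; [exact: ceil_closed| |].
    by move=> u /andP[/forest_below].
  by move=> u /andP[_ /negP nc] /andP[_ /nc].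
have d3d1 w : ceil_of r [:: b] w -> d3 w = d1 w by move=> wc;
  rewrite (same_dir smc3) // (same_dir sm2).
have djb3 : dir_inj d3 (ceil_of r [:: b]) by apply: (embeds_ceil gd3); rewrite inE.
have psb3 := embeds_pos gd3.
have far u u' : ceil_of r [:: b] u -> forest r K u' -> d3 u <> d3 u'.
  move=> uc un; rewrite (same_dir sm3 un) (d3d1 u uc) => e.
  by have [_ /negP] := K2 u' un; apply; rewrite -e mem_dirs_of // (forest_N (ceil_forest uc)).
exists d3; split.
- exact: keeps_floor_cons S'nd ag1 ag2 ag3.
- apply: embeds_cons => // w w' wn wn' e.
  have [|u uc eu] := branch_apart psb3 djb3 _ wn wn' e; first by move=> u u' /floor_ceil;
    apply: far.
  have [rw' ltrw'] := forest_root wn'; have /(_ (d3 u)) := (pos_flipP _ _ _ rw').2 eu.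
  rewrite eqxx; case: (boolP (d3 u \in dir_seq d3 r w')) => [/mapP[u' uP eu'] _|/count_memPn ->
    //].
  move: uP; rewrite mem_lineage ?prefix_leq // => /andP[uw' ltru].
  exact: (far u u' uc (forest_closed wn' uw' ltru)).
move=> w; rewrite (forest_cons r b K) => /orP[wn|wn].
  by apply: (branch_avoid bN wn djb3) => u uc; rewrite d3d1 //; apply: nz1; rewrite /= uc.
by rewrite (same_pos sm3) // (same_root sm3); apply: avz2.
Qed.

(** The ceiling halves have slightly more than half of the edges, and the
    argument of completable_loose lacks one edge. Still K can be completed
    without the colours of the ceiling half of b2 and without its floor
    directions, as well as without the colours and directions of the floor
    half of b1; since b1 has an odd number of edges, this leaves one
    edge to spare. So only the children in K are next to the root, and
    excluding at the root alone the remaining directions of the ceiling half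
    of b2 keeps K apart from b2. Next the ceiling half of b1 is labelled
    doubly distinctly from that of b2, and b1 is completed. There is again an
    edge to spare, because the colours of b2 outside of its ceiling half are
    free and b2 is not smaller than b1. Finally b2 is completed; it is apart
    from b1 by tight_apart. *)
Lemma completable_tight r b2 b1 K :
  (count (ceil_of r [:: b1]) N).*2 = (count (forest r [:: b1]) N).+1 ->
  (count (ceil_of r [:: b2]) N).*2 = (count (forest r [:: b2]) N).+1 ->
  count (forest r [:: b1]) N <= count (forest r [:: b2]) N ->
  (forall b, b \in [:: b2, b1 & K] -> completable (rcons r b) (children (rcons r b))) ->
  completable r [:: b2, b1 & K].
Proof.
move=> t1 t2 le12 IH E d z st degE dz nEz.
have [|w wf|i|d1 [ag1 ed1 rb1 dj1 nz]] := @open_branch E d r _ _ [:: z] st degE.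
- by [].
- by rewrite inE; apply/eqP/dz.
- by rewrite inE => /eqP ->.
have {nz}nz1 w : ceil_of r [:: b2] w || floor_of r (b1 :: K) w -> d1 w <> z.
  by move/nz; rewrite inE => /eqP.
have [UbK KN subE Wr _ _ _] := st.
have /andP[b2K /andP[b1K UK]] := UbK.
have b2N : rcons r b2 \in N by apply: KN; rewrite inE eqxx.
have b1N : rcons r b1 \in N by apply: KN; rewrite !inE eqxx orbT.
have KN' : {in K, forall c, rcons r c \in N} by move=> c cK; apply: KN; rewrite !inE cK !orbT.
have pE : proper_at colour E := proper_sub subE E0_proper.
have cn : count (forest r [:: b2, b1 & K]) N =
    count (forest r [:: b2]) N + (count (forest r [:: b1]) N + count (forest r K) N).
  by rewrite (count_forest_cons r b2K) (count_forest_cons r b1K).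
set v1 := rcons r b1; set v2 := rcons r b2.
have dis2 w : forest r [:: b2] w -> forest r (b1 :: K) w -> False by apply: forest_disjoint.
have dis1 w : forest r [:: b1] w -> forest r K w -> False by apply: forest_disjoint.
have in1 w : forest r [:: b1] w -> forest r (b1 :: K) w by rewrite (forest_cons r b1 K) => ->.
have inK w : forest r K w -> forest r (b1 :: K) w by rewrite (forest_cons r b1 K) orbC => ->.
pose S' w := ceil_of r [:: b2] w || floor_of r (b1 :: K) w.
have S'nd w : S' w -> forest r [:: b2, b1 & K] w.
  by rewrite (forest_cons r b2 (b1 :: K)) => /orP[/ceil_forest ->//|/floor_forest ->];
    rewrite orbT.
have r1 : pos d1 r = pos d r by apply: root_off ag1 => u /andP[/S'nd/forest_below[]].
have c2S w : ceil_of r [:: b2] w -> S' w by rewrite /S' => ->.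
have f1S w : floor_of r [:: b1] w -> S' w by rewrite /S' (floor_cons r b1 K) => ->; rewrite orbT.
have fKS w : floor_of r K w -> S' w by rewrite /S' (floor_cons r b1 K) => ->; rewrite !orbT.
(* Away from the root only the floor directions of b2 are excluded; excluding
   all its ceiling directions would cost one edge too many. *)
pose X1 := cols_of d1 (ceil_of r [:: b2]) ++ cols_of d1 (floor_of r [:: b1]).
pose Y1 x := dirs_of d1 (if x == pos d1 r then ceil_of r [:: b2] else floor_of r [:: b2]) ++
  dirs_of d1 (floor_of r [:: b1]).
pose E1 x := del_edges E X1 (Y1 x) x.
have subE1 x i : E1 x i -> E x i by apply: del_sub.
have [||||d2 [ag2 gd2 adj2]] := @complete_with_slack r K E1 d1.
- split=> //.
  + by move=> x i /subE1 /subE.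
  + by rewrite r1.
  + move=> w wf; have wn := floor_forest wf; have wS := fKS w wf.
    have apart2 u : ceil_of r [:: b2] u -> u <> w.
      by move=> /ceil_forest un uw; apply: (dis2 u) => //; rewrite uw; apply: inK.
    have apart1 u : floor_of r [:: b1] u -> u <> w.
      by move=> /floor_forest un uw; apply: (dis1 u) => //; rewrite uw.
    rewrite /E1 /del_edges ed1 //= !mem_cat !negb_or -!andbA; apply/and4P; split.
    * apply/cols_ofP => -[u /andP[_ uc] e]; apply: (apart2 u) => //.
      exact/esym/rb1/e/c2S.
    * apply/cols_ofP => -[u /andP[_ uc] e]; apply: (apart1 u) => //.
      exact/esym/rb1/e/f1S.
    * apply/dirs_ofP => -[u /andP[_ uc] e].
      have {}uc : ceil_of r [:: b2] u by move: uc; case: ifP => // _ /floor_ceil.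
      by apply: (apart2 u) => //; exact/esym/dj1/e/c2S.
    * apply/dirs_ofP => -[u /andP[_ uc] e]; apply: (apart1 u) => //.
      exact/esym/dj1/e/f1S.
  + by move=> w w' wf wf'; apply: rb1; apply: fKS.
  + by move=> w w' wf wf'; apply: dj1; apply: fKS.
- by move=> c cK; apply: IH; rewrite !inE cK !orbT.
- move=> x Wx /eqP/negPf xr; apply: (deg_del pE (degE x Wx)).
  rewrite /X1 /Y1 xr !size_cat !size_cols_of !size_dirs_of cn.
  have := branch_floor_ceil b2N; have := branch_floor b1N; move: t1; count_lia.
- apply: (deg_del pE (degE _ _)); first by rewrite r1.
  rewrite /X1 /Y1 eqxx !size_cat !size_cols_of !size_dirs_of cn.
  have := branch_floor b1N; move: t1 t2; count_lia.
have K2 w : forest r K w -> [/\ edge_col d2 w \notin cols_of d1 (ceil_of r [:: b2]),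
    edge_col d2 w \notin cols_of d1 (floor_of r [:: b1]) &
    d2 w \notin Y1 (pos d2 (parent w))].
  by move=> wn; have /and3P[_] := embeds_edges gd2 wn; rewrite mem_cat negb_or => /andP[].
pose S2 w := ceil_of r [:: b2] w || floor_of r [:: b1] w.
pose S3 w := ceil_of r [:: b2] w || ceil_of r [:: b1] w.
have S2S' w : S2 w -> S' w by case/orP => [/c2S|/f1S].
have S23 w : S2 w -> S3 w by rewrite /S3 => /orP[->//|/floor_ceil ->]; rewrite orbT.
have clS2 : anc_closed r S2 by apply: anc_closed_or; [exact: ceil_closed|exact: floor_closed].
have clS3 : anc_closed r S3 by apply: anc_closed_or; exact: ceil_closed.
have blS3 : below r S3 by apply: below_or; exact: ceil_below.
have blS2 : below r S2 by move=> w /S23/blS3.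
have S2K w : S2 w -> forest r K w -> False.
  by case/orP=> [/ceil_forest w2 /inK|/floor_forest]; [apply: dis2|apply: dis1].
have S3K w : S3 w -> forest r K w -> False.
  by case/orP=> [/ceil_forest w2 /inK|/ceil_forest]; [apply: dis2|apply: dis1].
have smS2 : same_on r d1 d2 S2.
  apply: same_disjoint ag2 => //; first by move=> u /andP[/forest_below].
  by move=> u /andP[un _] uS; apply: (S2K u).
have ce2v2 : ceil_of r [:: b2] v2 by exact: ceil_child.
have r2 : pos d2 r = pos d r by rewrite (same_root smS2).
have Wr2 : W (pos d2 r) by rewrite r2.
have [|||||d3 [ag3 ed3 rb3 dj3 fr3]] :=
    @greedy E d2 r S2 S3 (cols_of d2 (forest r K)) [::] _ subE Wr2 degE clS2 clS3 blS3 S23.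
- by apply: (same_edges smS2) => w /S2S'/ed1.
- by apply: (same_col_inj smS2) => w w' /S2S' wS /S2S'; apply: rb1.
- by apply: (same_dir_inj smS2) => w w' /S2S' wS /S2S'; apply: dj1.
- rewrite size_cols_of addn0 cn.
  have := count_or_leq (ceil_of r [:: b2]) (ceil_of r [:: b1]) N; rewrite -/S3; move: t1 t2;
    count_lia.
- by move=> w _ _ _; apply: Or33; exists v2; rewrite ?parent_rcons // /S2 ce2v2.
have smK3 : same_on r d2 d3 (forest r K).
  apply: same_disjoint ag3; [exact: forest_closed| |].
    by move=> u /andP[/blS3].
  by move=> u /andP[uS _]; apply: S3K.
have sm23 : same_on r d2 d3 S2.
  by apply: same_disjoint ag3 => //; [move=> u /andP[/blS3]|move=> u /andP[_ /negP]].
have r3 : pos d3 r = pos d r by rewrite (same_root smK3).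
have c2S2 w : ceil_of r [:: b2] w -> S2 w by rewrite /S2 => ->.
have f1S2 w : floor_of r [:: b1] w -> S2 w by rewrite /S2 orbC => ->.
have c2S3 w : ceil_of r [:: b2] w -> S3 w by rewrite /S3 => ->.
have c1S3 w : ceil_of r [:: b1] w -> S3 w by rewrite /S3 orbC => ->.
have col31 w : S2 w -> edge_col d3 w = edge_col d1 w.
  by move=> wS; rewrite (same_col sm23) // (same_col smS2).
have dir31 w : S2 w -> d3 w = d1 w.
  by move=> wS; rewrite (same_dir sm23) // (same_dir smS2).
have K3 w : forest r K w -> [/\ forall u, S2 u -> edge_col d3 u <> edge_col d3 w,
    forall u, floor_of r [:: b2] u || floor_of r [:: b1] u -> d3 u <> d3 w &
    parent w = r -> forall u, ceil_of r [:: b2] u -> d3 u <> d3 w].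
  move=> wn; have [nc2 nf1 nY] := K2 w wn; split=> [u uS|u uf|pw u uc].
  - rewrite col31 // (same_col smK3 wn) => e; case/orP: uS => us.
      by case/negP: nc2; rewrite -e mem_cols_of // (forest_N (ceil_forest us)).
    by case/negP: nf1; rewrite -e mem_cols_of // (forest_N (floor_forest us)).
  - have uS : S2 u by case/orP: uf => [/floor_ceil/c2S2|/f1S2].
    rewrite dir31 // (same_dir smK3 wn) => e; case/negP: nY; rewrite -e mem_cat.
    case/orP: uf => uf; last by rewrite orbC mem_dirs_of // (forest_N (floor_forest uf)).
    rewrite mem_dirs_of ?(forest_N (floor_forest uf)) //; case: ifP => // _; exact: floor_ceil.
  rewrite dir31 ?c2S2 // (same_dir smK3 wn) => e; case/negP: nY; rewrite -e mem_cat.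
  by rewrite pw (same_root smS2) eqxx mem_dirs_of ?(forest_N (ceil_forest uc)).
have adj3 : adjacent_children d3 r (forest r K).
  move=> w i wn; rewrite (same_pos smK3) // (same_root smK3); exact: adj2.
pose Ea := del_edges E (cols_of d3 (ceil_of r [:: b2])) [::].
have subEa x i : Ea x i -> E x i by apply: del_sub.
have gdK3 : embeds Ea d3 r K.
  have [ed rb ps cl] := embeds_same smK3 gd2.
  split=> //; apply: edges_del => //; first by move=> w /ed/subE1.
  move=> w wn; apply/cols_ofP => -[u /andP[_ uc] e].
  by have [h _ _] := K3 w wn; case: (h u (c2S2 u uc)).
have [|||||||||||d4 [ag4 gd4 gdK4 xcol4 av4]] := @add_branch Ea d3 d3 r b1 K [:: d3 v1] b1K b1N.
- by apply: IH; rewrite !inE eqxx orbT.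
- by move=> x i /subEa/subE.
- by rewrite r3.
- apply: edges_del => //; first by move=> w /c1S3/ed3.
  move=> w wc; apply/cols_ofP => -[u /andP[_ uc] e].
  apply: (dis2 u); first exact: ceil_forest.
  by rewrite -(rb3 w u (c1S3 w wc) (c2S3 u uc) e); apply/in1/ceil_forest.
- by move=> w w' /c1S3 wS /c1S3; apply: rb3.
- by move=> w w' /c1S3 wS /c1S3; apply: dj3.
- by [].
- exact: gdK3.
- move=> w u wn uc e; have [h _ _] := K3 w wn.
  have [uS|nuS] := boolP (S2 u); first by case: (h u uS).
  have [/negP nX _] := fr3 u (c1S3 u uc) nuS; apply: nX.
  by rewrite -e (same_col smK3) // mem_cols_of // (forest_N wn).
- by move=> i; rewrite inE => /eqP.
- move=> x Wx; have [le1|gt1] := leqP (count (forest r [:: b1]) N) 1.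
    (* a branch with a single edge has nothing left to place *)
    by exists [::]; split=> //; move: le1; count_lia.
  apply: (@deg_mono (del_edges E ((edge_col d3 v1 :: cols_of d3 (forest r K)) ++
    cols_of d3 (ceil_of r [:: b2])) [:: d3 v1])).
    by move=> i /and3P[Ei]; rewrite mem_cat negb_or => /andP[nX nX'] nY;
      rewrite /del_edges /Ea /del_edges Ei nX nX' nY.
  apply: (deg_del pE (degE x Wx)); rewrite size_cat /= !size_cols_of cn.
  by move: gt1 le12 t2; count_lia.
have smK4 : same_on r d3 d4 (forest r K).
  apply: same_disjoint ag4; [exact: forest_closed| |].
    by move=> u /andP[/forest_below].
  by move=> u /andP[un _]; apply: dis1.
have sm24 : same_on r d3 d4 (ceil_of r [:: b2]).
  apply: same_disjoint ag4; [exact: ceil_closed| |].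
    by move=> u /andP[/forest_below].
  by move=> u /andP[/in1 un _] /ceil_forest u2; apply: (dis2 u).
have sm14 : same_on r d3 d4 (ceil_of r [:: b1]).
  apply: same_disjoint ag4; [exact: ceil_closed| |].
    by move=> u /andP[/forest_below].
  by move=> u /andP[_ /negP nc] /andP[_ /nc].
have dj14 : dir_inj d4 (ceil_of r [:: b1]) by apply: (embeds_ceil gd4); rewrite inE.
have ps14 := embeds_pos gd4.
have dv4 w : forest r [:: b1] w -> w <> v1 -> d4 w <> d4 v1.
  move=> wn wv; have := av4 w wn wv; rewrite inE => /eqP.
  by rewrite (same_dir sm14 (ceil_child b1N)).
have adj4 : adjacent_children d4 r (forest r K).
  move=> w i wn; rewrite (same_pos smK4) // (same_root smK4); exact: adj3.
have gd14 : embeds Ea d4 r (b1 :: K).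
  apply: embeds_cons => //; apply: (slack_apart b1N ps14 dj14 dv4 adj4) => //.
  move=> u u' uf un; have [_ h _] := K3 u' un.
  rewrite (same_dir smK4 un) (same_dir sm14 (floor_ceil uf)); apply: h.
  by rewrite uf orbT.
have r4 : pos d4 r = pos d r by rewrite (same_root smK4).
have [|||||||||||d5 [ag5 gd5 gd15 xcol5 _]] := @add_branch E d4 d4 r b2 (b1 :: K) [::] b2K b2N.
- by apply: IH; rewrite !inE eqxx.
- exact: subE.
- by rewrite r4.
- by apply: (same_edges sm24) => w /c2S3/ed3.
- by apply: (same_col_inj sm24) => w w' /c2S3 wS /c2S3; apply: rb3.
- by apply: (same_dir_inj sm24) => w w' /c2S3 wS /c2S3; apply: dj3.
- by [].
- exact: embeds_sub subEa gd14.
- move=> w u wn uc e; have /and3P[_ /negP nX _] := embeds_edges gd14 wn; apply: nX.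
  by rewrite -/(edge_col d4 w) e (same_col sm24) // mem_cols_of // (forest_N (ceil_forest uc)).
- by [].
- move=> x Wx; apply: (deg_del pE (degE x Wx)) => /=.
  rewrite size_cols_of cn (count_forest_cons r b1K).
  have : 0 < count (forest r [:: b2]) N by rewrite count_forest_branch.
  count_lia.
have sm15 : same_on r d4 d5 (forest r (b1 :: K)).
  apply: same_disjoint ag5; [exact: forest_closed| |].
    by move=> u /andP[/forest_below].
  by move=> u /andP[un _]; apply: dis2.
have sm25 : same_on r d4 d5 (ceil_of r [:: b2]).
  apply: same_disjoint ag5; [exact: ceil_closed| |].
    by move=> u /andP[/forest_below].
  by move=> u /andP[_ /negP nc] /andP[_ /nc].
have dj25 : dir_inj d5 (ceil_of r [:: b2]) by apply: (embeds_ceil gd5); rewrite inE.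
have ps25 := embeds_pos gd5.
have r5 : pos d5 r = pos d r by rewrite (same_root sm15).
have d5c2 w : ceil_of r [:: b2] w -> d5 w = d3 w.
  by move=> wc; rewrite (same_dir sm25) // (same_dir sm24).
have d5c1 w : ceil_of r [:: b1] w -> d5 w = d3 w.
  by move=> wc; rewrite (same_dir sm15 (in1 _ (ceil_forest wc))) (same_dir sm14).
have d5K w : forest r K w -> d5 w = d3 w.
  by move=> wn; rewrite (same_dir sm15 (inK _ wn)) (same_dir smK4).
have adj5 : adjacent_children d5 r (forest r K).
  move=> w i wn; rewrite (same_pos sm15 (inK _ wn)) (same_root sm15); exact: adj4.
have dj5 : dir_inj d5 S3.
  have d5S w : S3 w -> d5 w = d3 w by case/orP => [/d5c2|/d5c1].
  by move=> w w' wS wS'; rewrite !d5S //; apply: dj3.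
exists d5; split.
- have ag12 : agree_off (fun w => forest r [:: b2, b1 & K] w && ~~ in_floor r w) d d2.
    apply: (@agree_off_trans _ _ d d1).
      by apply: agree_off_sub ag1 => w /andP[/S'nd wn]; rewrite /floor_of wn.
    by apply: agree_off_sub ag2 => w /andP[/inK wn ->];
      rewrite (forest_cons r b2 (b1 :: K)) wn orbT.
  apply: (agree_off_trans ag12); apply: (@agree_off_trans _ _ d2 d3).
    apply: agree_off_sub ag3 => w /andP[/orP[wc|wc]]; first by rewrite c2S2.
    move=> nS2; rewrite (forest_cons r b2 (b1 :: K)) (in1 _ (ceil_forest wc)) orbT /=.
    by apply: contra nS2 => wf; apply: f1S2; rewrite /floor_of (ceil_forest wc).
  apply: (@agree_off_trans _ _ d3 d4).
    apply: agree_off_sub ag4 => w /andP[/in1 wn nc];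
      rewrite (forest_cons r b2 (b1 :: K)) wn orbT /=.
    by apply: contra nc; apply: in_floor_ceil.
  apply: agree_off_sub ag5 => w /andP[wn nc]; rewrite (forest_cons r b2 (b1 :: K)) wn /=.
  by apply: contra nc; apply: in_floor_ceil.
- apply: embeds_cons => // w w' wn; rewrite (forest_cons r b1 K) => /orP[wn'|wn'].
    apply: (tight_apart _ dj5 _ wn wn').
      by move: b2K; rewrite !inE; apply: contra => ->.
    move=> ev; exact: (tight_branch_leaf b2N t2 wn ev).
  move=> e; have [|u uc eu] := branch_apart ps25 dj25 _ wn wn' e.
    move=> u u' uf un; have [_ h _] := K3 u' un.
    by rewrite (d5c2 u (floor_ceil uf)) d5K //; apply: h; rewrite uf.
  have [_ ltrw'] := forest_root wn'; have pw' := adj5 _ _ wn' eu.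
  have [_ _ h] := K3 w' wn'; apply: (h pw' u uc).
  rewrite -(d5c2 u uc) -(d5K w' wn'); apply: (@flip_inj (pos d5 r)).
  by rewrite -eu -(child_pos d5 pw' ltrw').
have nz3 u : S2 u -> d3 u <> z by move=> uS; rewrite dir31 //; apply/nz1/S2S'.
have childz w : forest r (b1 :: K) w -> parent w = r -> pos d5 w <> flip (pos d5 r) z.
  move=> wn pw; have [_ ltrw] := forest_root wn.
  rewrite (child_pos d5 pw ltrw) => /flip_inj e; case/negP: nEz.
  by have := embeds_edges gd15 wn; rewrite e pw r5.
move=> w; rewrite (forest_cons r b2 (b1 :: K)) => /orP[wn|wn].
  by apply: (branch_avoid b2N wn dj25) => u uc; rewrite d5c2 //; apply/nz3/c2S2.
move=> e; apply: (childz w wn) => //; move: wn; rewrite (forest_cons r b1 K) => /orP[wn|wn].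
  have e4 : pos d4 w = flip (pos d4 r) z.
    by rewrite -(same_pos sm15 (in1 _ wn)) -(same_root sm15).
  by rewrite (branch_adjacent b1N wn ps14 dv4 e4) parent_rcons.
exact: (adj5 _ _ wn e).
Qed.

Lemma forest_perm r K K' : perm_eq K K' -> forest r K = forest r K'.
Proof.
move=> KK'; apply: funext => w; rewrite /forest; congr (_ && _).
by apply/eq_has_r/perm_mem.
Qed.

Lemma completable_perm r K K' : perm_eq K K' -> completable r K -> completable r K'.
Proof.
move=> KK' cK E d z [UK KN subE Wr ed rb dj] degE nz nEz.
have nE := forest_perm r KK'; have fE : floor_of r K = floor_of r K' by rewrite /floor_of nE.
have mK := perm_mem KK'.
have [||||d' [comp [ed' rb' ps' cl'] avz]] := cK E d z.
- by split; rewrite ?fE ?(perm_uniq KK') // => b; rewrite mK; apply: KN.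
- by rewrite nE.
- by rewrite fE.
- exact: nEz.
exists d'; split; [by rewrite /keeps_floor -nE| |by rewrite -nE].
by split; rewrite -?nE // => b; rewrite -mK; apply: cl'.
Qed.

(** Induction on the number of edges. A loose branch is split off if there is
    one, and a single branch needs no degree for the empty rest. Otherwise two
    tight branches are taken, the smaller one in the role of b1. *)
Lemma completable_all r K : completable r K.
Proof.
have [n] := ubnP (count (forest r K) N); elim: n r K => // n IH r K; rewrite ltnS => Kn.
case: (EM (uniq K /\ {in K, forall b, rcons r b \in N})) => [[UK KN]|nst]; last first.
  by move=> E d z [UK KN]; case: nst.
have child b : b \in K -> completable (rcons r b) (children (rcons r b)).
  move=> bK; apply: IH; apply: leq_trans Kn; rewrite -count_forest_branch ?KN //.
  by apply: sub_count => w; apply: forest_mem.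
have smaller b K' : perm_eq (b :: K') K -> completable r K'.
  move=> pK; have bK : b \in K by rewrite -(perm_mem pK) inE eqxx.
  have := UK; rewrite -(perm_uniq pK) => /andP[bK' _].
  apply: IH; apply: leq_trans Kn; rewrite -(forest_perm r pK) (count_forest_cons r bK').
  by rewrite (count_forest_branch (KN b bK)) addSn ltnS leq_addl.
have [/hasP[b bK loose]|/hasPn tight] :=
    boolP (has (fun b => (count (ceil_of r [:: b]) N).*2 <= count (forest r [:: b]) N) K).
  have pK : perm_eq (b :: rem b K) K by rewrite perm_sym perm_to_rem.
  apply: (completable_perm pK); apply: completable_loose; [by right|exact: child|].
  exact: smaller pK.
have {}tight b : b \in K -> (count (ceil_of r [:: b]) N).*2 = (count (forest r [:: b]) N).+1.
  move=> bK; apply/eqP; rewrite eqn_leq branch_ceil ?KN //=.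
  by rewrite ltnNge tight.
case: K => [|b1 [|b2 K]] in UK KN Kn child smaller tight *.
- by move=> E d z st _ _ _; exists d; split; [|exact: embeds_nil|move=> w; rewrite /forest andbF].
- apply: completable_loose; [by left|by apply: child; rewrite inE|].
  by apply: (smaller b1).
have [le|le] := leqP (count (forest r [:: b1]) N) (count (forest r [:: b2]) N).
  apply: (@completable_perm r [:: b2, b1 & K]).
    by rewrite (perm_catCA [:: b2] [:: b1] K).
  apply: (completable_tight _ _ le);
    [by apply: tight; rewrite !inE eqxx|by apply: tight; rewrite !inE eqxx orbT|].
  by move=> b bK; apply: child; move: bK; rewrite !inE orbCA.
apply: (completable_tight _ _ (ltnW le));
  [by apply: tight; rewrite !inE eqxx orbT|by apply: tight; rewrite !inE eqxx|].
exact: child.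
Qed.

End Forests.

Local Open Scope fset_scope.

(** * Paths in trees *)

Section Graphs.
Variable V : choiceType.
Implicit Types (F : graph V) (x y : V) (p q : seq V).

Lemma fset2_inv x y u v : [fset x; y] = [fset u; v] :> {fset V} ->
  (x = u /\ y = v) \/ (x = v /\ y = u).
Proof.
move=> e; have xP : x \in [fset u; v] by rewrite -e fset21.
have yP : y \in [fset u; v] by rewrite -e fset22.
have uP : u \in [fset x; y] by rewrite e fset21.
have vP : v \in [fset x; y] by rewrite e fset22.
case/fset2P: xP => xE; case/fset2P: yP => yE; [|by left|by right|].
  by left; split=> //; case/fset2P: vP => vE; rewrite vE ?yE ?xE.
by left; split=> //; case/fset2P: uP => uE; rewrite uE ?yE ?xE.
Qed.

Lemma mem_edges F x y : adj F x y -> [fset x; y] \in edges F.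
Proof.
move=> xy; apply/imfset2P; exists x; first exact: adj_verts xy.
exists y => //; rewrite !inE /= xy andbT.
by apply: (@adj_verts _ F y x); rewrite adj_sym.
Qed.

Lemma edges_inv F x y : [fset x; y] \in edges F -> adj F x y.
Proof.
case/imfset2P => x' _ [y']; rewrite !inE /= => /andP[_ xy] /fset2_inv[[-> ->]//|[-> ->]].
by rewrite adj_sym.
Qed.

Lemma rev_is_path F x p y : is_path F x p y -> is_path F y (rev (belast x p)) x.
Proof.
case=> xp Ux <-; split.
- by rewrite rev_path (eq_path (e' := adj F)) // => u v; apply: adj_sym.
- by rewrite -rev_rcons -lastI rev_uniq.
by case/lastP: p {xp Ux} => //= p a; rewrite belast_rcons rev_cons last_rcons.
Qed.

(** Where two paths part, the walk along one and back along the other joins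
    two neighbours of x without using x, which closes a cycle. *)
Lemma acyclic_path_unique F x p q : acyclic F ->
  path (adj F) x p -> uniq (x :: p) -> path (adj F) x q -> uniq (x :: q) ->
  last x p = last x q -> p = q.
Proof.
move=> acy; elim: p x q => [|a p IH] x [|b q] //.
- by move=> _ _ _ /= /andP[xq _] e; move: xq; rewrite e mem_last.
- by move=> _ /= /andP[xp _] _ _ e; move: xp; rewrite -e mem_last.
move=> /=/andP[xa ap] /andP[xnp Up] /andP[xb bq] /andP[xnq Uq] e.
have [ab|ab] := eqVneq a b; first by rewrite -ab in bq Uq e *; rewrite (IH a q).
have [rq Urq lq] := rev_is_path (And3 bq Uq erefl).
(* along p from a to the common end, and back along q to b *)
have ps : path (adj F) a (p ++ rev (belast b q)) by rewrite cat_path ap e.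
have : last a (p ++ rev (belast b q)) = b by rewrite last_cat e.
case/shortenP: ps => s as_ Us sub lastb.
case: (acy [:: x, a & s]).
  by case: s lastb {as_ Us sub} => //= ab'; rewrite ab' eqxx in ab.
rewrite /ucycle /= rcons_path xa as_ lastb adj_sym xb /= -[(a \notin s) && _]/(uniq (a :: s)) Us andbT.
apply/negP; rewrite inE => /predU1P[xa'|/sub].
  by move: xnp; rewrite xa' inE eqxx.
rewrite mem_cat mem_rev => /orP[xp|/mem_belast xq].
  by move: xnp; rewrite inE xp orbT.
by rewrite xq in xnq.
Qed.

End Graphs.

(** * Subgraphs of the cube given by directions *)

Section Cube.
Implicit Types x y : cube.

Lemma edge_coordP {x y i} : edge_coord x y i -> y = flip x i.
Proof.
case=> xy un; apply: funext => j; rewrite /flip.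
case: eqP => [->|ji]; first by move: xy; case: (x i); case: (y i).
by have := un j; case: (x j); case: (y j) => //= /(_ isT) /esym.
Qed.

Lemma flip_edge_coord x i : edge_coord x (flip x i) i.
Proof.
split=> [|j]; rewrite /flip ?eqxx; first by case: (x i).
by case: (j =P i) => // _; rewrite addbF eqxx.
Qed.

Lemma flip_coord x i j : edge_coord x (flip x i) j -> i = j.
Proof. by move/edge_coordP/flip_inj. Qed.

Lemma edge_coord_sym x y i : edge_coord x y i -> edge_coord y x i.
Proof. by case=> xy un; split=> [|j]; rewrite eq_sym //; apply: un. Qed.

Definition coord_of x y : nat :=
  if pselect (cube_adj x y) is left h then projT1 (cid h) else 0.

Lemma coord_ofP x y : cube_adj x y -> y = flip x (coord_of x y).
Proof.
move=> xy; rewrite /coord_of; case: pselect => // h.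
exact: edge_coordP (projT2 (cid h)).
Qed.

End Cube.

Section CubeGraph.
Variables (G : graph cube) (C : Type) (c : {fset cube} -> C).
Hypotheses (GQ : cube_subgraph G) (c_proper : proper_coloring G c).
Implicit Types x y : cube.

Definition Gdir (x : cube) : pred nat := fun i => adj G x (flip x i).
Definition Gcol (x : cube) (i : nat) : {classic C} := c [fset x; flip x i].

Lemma Gcol_sym x i : Gcol (flip x i) i = Gcol x i.
Proof. by rewrite /Gcol flipK fsetUC. Qed.

Lemma Gdir_proper : proper_at Gcol Gdir.
Proof.
move=> x i j xi xj e; apply: contrapT => ij;
  suff /(_ e) : c [fset x; flip x i] <> c [fset x; flip x j] by [].
by apply: c_proper xi xj _ => /flip_inj.
Qed.

Lemma Gdir_verts x i : Gdir x i -> flip x i \in verts G.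
Proof. by rewrite /Gdir adj_sym; apply: adj_verts. Qed.

Lemma min_degree_le x : x \in verts G -> min_degree G <= degree G x.
Proof.
rewrite /min_degree; move: #|` _| => m xG.
have {xG} : x \in (verts G : seq cube) by [].
elim: (verts G : seq cube) => //= y s IH; rewrite inE big_cons.
by case/predU1P => [->|/IH xs]; rewrite ?geq_minl // geq_min xs orbT.
Qed.

Lemma Gdir_deg x k : k <= min_degree G -> x \in verts G -> deg_ge Gdir x k.
Proof.
move=> degG xG; exists [seq coord_of x y | y <- neighbors G x].
have nP y : y \in neighbors G x -> y = flip x (coord_of x y).
  by rewrite !inE => /andP[_ /GQ]; apply: coord_ofP.
split.
- rewrite map_inj_in_uniq ?fset_uniq // => y y' /nP yx /nP y'x e.
  by rewrite yx y'x e.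
- apply/allP => i /mapP[y yn ->]; rewrite /Gdir -nP //.
  by move: yn; rewrite !inE => /andP[].
by rewrite size_map; exact: (leq_trans degG (min_degree_le xG)).
Qed.

End CubeGraph.

(** * Rooted trees as sets of words *)

Section Tree.
Variables (V : choiceType) (T : graph V) (v0 : V).
Hypotheses (treeT : is_tree T) (v0T : v0 \in verts T).
Implicit Types (x y v w : V) (p q u : seq V).

Definition addr v : seq V :=
  if pselect (exists p, is_path T v0 p v) is left h then projT1 (cid h) else [::].

Definition words : seq (seq V) := [seq addr v | v <- verts T].

Local Notation vtx p := (last v0 p).

Lemma addr_path v : v \in verts T -> is_path T v0 (addr v) v.
Proof.
move=> vT; rewrite /addr; case: pselect => [h|[]]; first exact: projT2 (cid h).
by case: treeT => _ con _; apply: con.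
Qed.

Lemma addrK v : v \in verts T -> vtx (addr v) = v.
Proof. by case/addr_path. Qed.

Lemma path_verts p : path (adj T) v0 p -> {subset v0 :: p <= verts T}.
Proof.
elim: p v0 v0T => [|a p IH] x xT /=; first by move=> _ y; rewrite inE => /eqP ->.
case/andP=> xa ap; have aT : a \in verts T by apply: (@adj_verts _ T a x); rewrite adj_sym.
by move=> y; rewrite inE => /predU1P[->//|]; apply: IH.
Qed.

Lemma addr_unique v p : is_path T v0 p v -> addr v = p.
Proof.
case=> pp Up lp; have vT : v \in verts T by apply: (path_verts pp); rewrite -lp mem_last.
have [aa Ua la] := addr_path vT; case: treeT => _ _ acy.
by apply: (acyclic_path_unique acy aa Ua pp Up); rewrite la.
Qed.

Lemma mem_words p : (p \in words) = path (adj T) v0 p && uniq (v0 :: p).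
Proof.
apply/mapP/andP => [[v vT ->]|[pp Up]]; first by have [] := addr_path vT.
exists (vtx p); first by apply: (path_verts pp); rewrite mem_last.
by rewrite (addr_unique (And3 pp Up erefl)).
Qed.

Lemma vtxK p : p \in words -> addr (vtx p) = p.
Proof. by rewrite mem_words => /andP[pp Up]; apply: addr_unique. Qed.

Lemma addr_words v : v \in verts T -> addr v \in words.
Proof. exact: map_f. Qed.

Lemma vtx_verts p : p \in words -> vtx p \in verts T.
Proof. by rewrite mem_words => /andP[/path_verts pp _]; apply: pp; apply: mem_last. Qed.

Lemma vtx_inj : {in words &, injective (fun p => vtx p)}.
Proof. by move=> p q pN qN e; rewrite -(vtxK pN) e vtxK. Qed.

Lemma words_uniq : uniq words.
Proof.
rewrite map_inj_in_uniq ?fset_uniq // => v w vT wT e.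
by rewrite -(addrK vT) e addrK.
Qed.

Lemma words_prefix p q : prefix p q -> q \in words -> p \in words.
Proof.
case/prefixP=> s ->; rewrite !mem_words cat_path -cat_cons cat_uniq.
by case/andP=> /andP[-> _] /andP[-> _].
Qed.

Lemma nil_words : [::] \in words.
Proof. by rewrite mem_words. Qed.

Lemma words_adj p a : rcons p a \in words -> adj T (vtx p) a.
Proof. by rewrite mem_words rcons_path => /andP[/andP[_ ->]]. Qed.

Lemma parent_adj p : p \in words -> 0 < size p -> adj T (vtx (parent p)) (vtx p).
Proof.
case/lastP: p => // p a pN _; rewrite parent_rcons last_rcons; exact: words_adj.
Qed.

(** If y is not on the path to x, the edge prolongs that path. Otherwise it
    prolongs the part of the path that ends in y, and this is the path to x by
    uniqueness. *)
Lemma adj_addr x y : adj T x y -> addr y = rcons (addr x) y \/ addr x = rcons (addr y) x.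
Proof.
move=> xy; have xT := adj_verts xy; have yx : adj T y x by rewrite adj_sym.
have yT := adj_verts yx; have [px Ux lx] := addr_path xT.
have [yin|ynin] := boolP (y \in v0 :: addr x); last first.
  left; apply: addr_unique; split; rewrite ?last_rcons //.
    by rewrite rcons_path px lx.
  by rewrite -rcons_cons rcons_uniq ynin.
right; suff key p : is_path T v0 p x -> y \in v0 :: p -> p = rcons (addr y) x.
  exact: key (addr_path xT) yin.
move=> pP; have [pp Up lp] := pP; rewrite -(addr_unique pP) => yp.
rewrite (addr_unique pP) in yp; case/splitPl: yp pp Up lp => p1 p2 ly.
rewrite cat_path -cat_cons cat_uniq last_cat ly.
case/andP=> pp1 pp2 /and3P[Up1 /hasPn dis _] lx'.
rewrite (addr_unique (And3 pp1 Up1 ly)).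
apply: addr_unique; split; rewrite ?last_rcons ?rcons_path ?pp1 ?ly //.
rewrite -rcons_cons rcons_uniq Up1 andbT; apply: dis; rewrite -lx'.
by case: p2 lx' {pp2} => [xy'|a s _]; [move: xy; rewrite -xy' /= adj_irr|rewrite /= mem_last].
Qed.

Lemma descendant_prefix v w : v \in verts T -> w \in verts T ->
  descendant T v0 v w = prefix (addr v) (addr w).
Proof.
move=> vT wT; apply/asboolP/idP => [[p pw vp]|vw].
  rewrite (addr_unique pw); have [pp Up _] := pw.
  case/splitPl: vp pp Up => p1 p2 <-; rewrite cat_path -cat_cons cat_uniq.
  move=> /andP[pp1 _] /andP[Up1 _]; rewrite (addr_unique (And3 pp1 Up1 erefl)).
  exact: prefix_prefix.
exists (addr w); first exact: addr_path.
rewrite -{1}(addrK vT); case/prefixP: vw => s ->.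
by rewrite -cat_cons mem_cat mem_last.
Qed.

Lemma size_addr v : v \in verts T -> size (addr v) < #|` verts T|.
Proof.
move=> vT; have [pp Up _] := addr_path vT.
by rewrite -[(size _).+1]/(size (v0 :: addr v)); apply: uniq_leq_size => //; apply: path_verts.
Qed.

Lemma level_addr v : v \in verts T -> level T v0 v = size (addr v).
Proof.
move=> vT; rewrite /level /dist; have lt := size_addr vT.
rewrite (eq_find (_ : _ =1 pred1 (size (addr v)))).
  have := @index_uniq _ 0 (size (addr v)) (iota 0 #|` verts T|).
  by rewrite size_iota iota_uniq nth_iota // add0n; apply.
move=> n /=; apply/asboolP/eqP => [[p pv <-]|->].
  by have := addr_unique (rev_is_path pv) => ->; rewrite size_rev size_belast.
exists (rev (belast v0 (addr v))); last by rewrite size_rev size_belast.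
exact/rev_is_path/addr_path.
Qed.

Lemma level_max_addr v : v \in verts T -> level_max T v0 v = max_level words (addr v).
Proof.
move=> vT; rewrite /level_max /max_level /words big_map big_seq_cond [RHS]big_seq_cond.
apply: eq_big => [w|w /andP[wT _]]; last exact: level_addr.
by case wT: (w \in verts T) => //=; apply: descendant_prefix.
Qed.

Local Notation N := words.
Local Notation K := (children words [::]).

Lemma forest_words p : forest N [::] K p = (p \in N) && (p != [::]).
Proof. by rewrite (forest_children words_prefix) /desc prefix0s andbT. Qed.

Lemma floor_verts v : v \in verts T ->
  (v \in verts (floor_half T v0)) = (addr v == [::]) || floor_of N [::] K (addr v).
Proof.
move=> vT; rewrite !inE /= vT /= level_addr // level_max_addr // /floor_of forest_words addr_words //=.
rewrite /in_floor /= !subn0; case: eqP => [->|] //=.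
Qed.

Lemma ceil_verts v : v \in verts T ->
  (v \in verts (ceil_half T v0)) = (addr v == [::]) || ceil_of N [::] K (addr v).
Proof.
move=> vT; rewrite !inE /= vT /= level_addr // level_max_addr // /ceil_of forest_words addr_words //=.
rewrite /in_ceil /= !subn0; case: eqP => [->|] //=.
Qed.

Variables (G : graph cube) (C : Type) (c : {fset cube} -> C).
Hypotheses (GQ : cube_subgraph G) (c_proper : proper_coloring G c).
Hypothesis degG : num_edges T <= min_degree G.

(** If the two edges agreed with opposite orientations, each of the words
    would be the parent of the other. *)
Lemma word_edge_inj p p' : p \in N -> p' \in N -> 0 < size p -> 0 < size p' ->
  [fset vtx (parent p); vtx p] = [fset vtx (parent p'); vtx p'] -> p = p'.
Proof.
move=> pN p'N p0 p'0.
have parN q : q \in N -> parent q \in N by apply: (words_prefix (prefix_parent q)).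
case/fset2_inv => -[e1 e2]; first exact: (vtx_inj _ _ e2).
have s1 := congr1 size (vtx_inj (parN p pN) p'N e1).
have := congr1 size (vtx_inj pN (parN p' p'N) e2).
by move: s1; rewrite !size_parent; move: p0 p'0; move: (size p) (size p') => m n; clear; lia.
Qed.

Lemma edges_words x y : [fset x; y] \in edges T -> exists2 p, forest N [::] K p &
  [fset x; y] = [fset vtx (parent p); vtx p].
Proof.
move/edges_inv => xy; have xT := adj_verts xy.
have yT : y \in verts T by apply: (@adj_verts _ T y x); rewrite adj_sym.
case: (adj_addr xy) => e; [exists (addr y)|exists (addr x)].
- by rewrite forest_words // addr_words // e; case: (addr x).
- by rewrite addrK // e parent_rcons addrK.
- by rewrite forest_words // addr_words // e; case: (addr y).
by rewrite addrK // e parent_rcons addrK // fsetUC.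
Qed.

Lemma count_words : count (forest N [::] K) N <= num_edges T.
Proof.
rewrite -size_filter -(size_map (fun p => [fset vtx (parent p); vtx p])).
have forestP p : p \in [seq p <- N | forest N [::] K p] -> p \in N /\ 0 < size p.
  by rewrite mem_filter forest_words // => /andP[/andP[-> ]]; case: p.
apply: uniq_leq_size.
  rewrite map_inj_in_uniq ?filter_uniq ?words_uniq // => p q /forestP[pN p0] /forestP[qN q0].
  exact: word_edge_inj.
by move=> e /mapP[p /forestP[pN p0] ->]; apply/mem_edges/parent_adj.
Qed.

Lemma floor_words p : floor_of N [::] K p -> p \in N /\ 0 < size p.
Proof. by case/andP; rewrite forest_words => /andP[-> p0] _; split=> //; case: (p) p0. Qed.

Lemma floor_parent p : floor_of N [::] K p -> (parent p == [::]) || floor_of N [::] K (parent p).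
Proof.
move=> pf; case: eqP => //= /eqP p0.
by apply: (floor_closed words_prefix pf (prefix_parent p)); case: (parent p) p0.
Qed.

Lemma words_parent p : p \in N -> parent p \in N.
Proof. exact: words_prefix (prefix_parent p). Qed.

Lemma floor_vtx p : p \in N -> (p == [::]) || floor_of N [::] K p ->
  vtx p \in verts (floor_half T v0).
Proof. by move=> pN; rewrite floor_verts ?vtxK // vtx_verts. Qed.

Lemma floor_adj p : floor_of N [::] K p -> adj (floor_half T v0) (vtx (parent p)) (vtx p).
Proof.
move=> pf; have [pN p0] := floor_words pf.
have pv := floor_vtx pN; rewrite pf orbT in pv.
have qv := floor_vtx (words_parent pN) (floor_parent pf).
have := parent_adj pN p0; move: (pv isT) qv; rewrite !inE => /andP[_ pS] /andP[_ qS] pq.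
by rewrite /floor_half /= /induced_adj /= pq !inE pS qS.
Qed.

Lemma path_edges_words p e : e \in path_edges v0 p ->
  exists2 q, prefix q p && (0 < size q) & e = [fset vtx (parent q); vtx q].
Proof.
rewrite /path_edges; elim/last_ind: p => // p a IH.
rewrite -{1}cats1 pairmap_cat mem_cat => /orP[/IH[q /andP[qp q0] ->]|].
  by exists q; rewrite // q0 (prefix_trans qp (prefix_rcons p a)).
rewrite /= inE => /eqP ->; exists (rcons p a); last by rewrite parent_rcons last_rcons.
by rewrite prefix_refl size_rcons.
Qed.

Section Extension.
Variables (phi : V -> cube) (zbad : cube).
Hypothesis phi_hom : homomorphism (floor_half T v0) G phi.
Hypothesis phi_dd : doubly_distinct (floor_half T v0) c phi.
Hypothesis zbad_adj : cube_adj (phi v0) zbad.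
Hypothesis zbad_notG : ~~ adj G (phi v0) zbad.
Hypothesis zbad_coord : forall x y i, adj (floor_half T v0) x y ->
  edge_coord (phi v0) zbad i -> ~ edge_coord (phi x) (phi y) i.

Definition phi_dir (p : seq V) := coord_of (phi (vtx (parent p))) (phi (vtx p)).
Local Notation pos := (pos (phi v0)).
Local Notation W := (fun x : cube => x \in verts G).
Local Notation z := (coord_of (phi v0) zbad).

Lemma phi_dirP p : floor_of N [::] K p ->
  phi (vtx p) = flip (phi (vtx (parent p))) (phi_dir p).
Proof. by move=> pf; apply/coord_ofP/GQ/phi_hom.2/floor_adj. Qed.

Lemma pos_nil (d : seq V -> nat) : pos d [::] = phi v0.
Proof. by apply: funext => j; rewrite /pos /dir_seq /lineage /= addbF. Qed.

Lemma pos_phi_dir p : (p == [::]) || floor_of N [::] K p -> pos phi_dir p = phi (vtx p).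
Proof.
elim/last_ind: p => [|p a IH]; first by rewrite pos_nil.
case/orP=> [/eqP|pf]; first by case: (p).
by have := floor_parent pf; rewrite (phi_dirP pf) pos_rcons parent_rcons => /IH ->.
Qed.

Lemma pos_parent_phi_dir p : floor_of N [::] K p -> pos phi_dir (parent p) = phi (vtx (parent p)).
Proof. by move/floor_parent/pos_phi_dir. Qed.

Lemma col_phi_dir p : floor_of N [::] K p ->
  edge_col (Gcol c) (phi v0) phi_dir p = c [fset phi (vtx (parent p)); phi (vtx p)].
Proof. by move=> pf; rewrite /edge_col pos_parent_phi_dir // /Gcol -phi_dirP. Qed.

Lemma floor_edge p : floor_of N [::] K p ->
  [fset vtx (parent p); vtx p] \in edges (floor_half T v0).
Proof. by move/floor_adj/mem_edges. Qed.

Lemma seeded_phi_dir : seeded N (Gcol c) (Gdir G) W (phi v0) (Gdir G) phi_dir [::] K.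
Proof.
split=> //.
- exact: children_uniq.
- by move=> a; rewrite mem_children.
- by rewrite pos_nil; apply: phi_hom.1; apply: (floor_vtx (p := [::])) => //; apply: nil_words.
- move=> p pf; rewrite pos_parent_phi_dir // /Gdir -phi_dirP //; exact/phi_hom.2/floor_adj.
- move=> p q pf qf; rewrite !col_phi_dir // =>
  /(phi_dd.1 _ _ _ _ (floor_edge pf) (floor_edge qf)).
  by apply: word_edge_inj; case: (floor_words pf) (floor_words qf) => ? ? [].
move=> p q pf qf e; have [pN p0] := floor_words pf; have [qN q0] := floor_words qf.
apply: word_edge_inj => //; apply: (phi_dd.2 _ _ _ _ (phi_dir p) (floor_edge pf) (floor_edge qf)).
  by rewrite (phi_dirP pf); apply: flip_edge_coord.
by rewrite (phi_dirP qf) e; apply: flip_edge_coord.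
Qed.

(** The labelling of the words found by completable_all is read as a map on
    the vertices of T. A path in the ceiling half of T lies in a single
    branch, on whose ceiling half directions are distinct. *)
Lemma extension : exists Phi : V -> cube,
    [/\ extends (floor_half T v0) phi Phi,
        embedding T (delete_vertex G zbad) Phi,
        rainbow T c Phi
      & path_distinct (ceil_half T v0) v0 Phi].
Proof.
have zE := coord_ofP zbad_adj.
have [|||d [comp gd avz]] := @completable_all _ N words_prefix words_uniq _ _ _ W (phi v0)
    (@Gcol_sym _ c) (Gdir_proper c_proper) (@Gdir_verts G) [::] K (Gdir G) phi_dir z seeded_phi_dir.
- by move=> x xG; apply: deg_leq count_words _; apply: Gdir_deg.
- move=> p pf e; apply: (zbad_coord (floor_adj pf) (i := z)).
    by rewrite {1}zE; apply: flip_edge_coord.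
  by rewrite (phi_dirP pf) e; apply: flip_edge_coord.
- by rewrite pos_nil /Gdir -zE.
pose Phi v := pos d (addr v); exists Phi.
have ndW p : p \in N -> p == [::] \/ forest N [::] K p.
  by move=> pN; rewrite forest_words pN; case: (p == [::]); [left|right].
have placed p : p \in N -> pos d p \in verts (delete_vertex G zbad).
  move=> pN; suff [pG /eqP pz] : pos d p \in verts G /\ pos d p <> zbad by rewrite !inE pG pz.
  case: (ndW p pN) => [/eqP ->|pn].
    rewrite pos_nil; split; last by rewrite zE => /esym; apply: flip_neq.
    by rewrite -(pos_nil phi_dir); apply: seeded_root seeded_phi_dir.
  have [_ p0] := forest_root pn; split.
    by rewrite (pos_parent _ _ p0); apply/Gdir_verts/(embeds_edges gd).
  by have := avz p pn; rewrite pos_nil -zE.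
have child p a : rcons p a \in N -> adj (delete_vertex G zbad) (pos d p) (pos d (rcons p a)).
  move=> pN; have paN := placed _ pN.
  have pa := placed _ (words_prefix (prefix_rcons p a) pN).
  case: (ndW _ pN) => [/eqP|pn]; first by case: (p).
  have := embeds_edges gd pn; rewrite parent_rcons pos_rcons /Gdir => pe.
  rewrite /delete_vertex /= /induced_adj /= -pos_rcons.
  move: paN pa; rewrite !inE => /andP[_ ->] /andP[_ ->].
  by rewrite pos_rcons.
have cPhi p : forest N [::] K p ->
    c [fset Phi (vtx (parent p)); Phi (vtx p)] = edge_col (Gcol c) (phi v0) d p.
  move=> pn; have pN := forest_N pn; have [_ p0] := forest_root pn.
  by rewrite /Phi !vtxK ?words_parent // (pos_parent _ _ p0).
have iPhi p i : forest N [::] K p -> edge_coord (Phi (vtx (parent p))) (Phi (vtx p)) i -> d p = i.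
  move=> pn; have pN := forest_N pn; have [_ p0] := forest_root pn.
  by rewrite /Phi !vtxK ?words_parent // (pos_parent _ _ p0) => /flip_coord.
split.
- move=> x xF; have xT : x \in verts T by move: xF; rewrite inE => /andP[].
  have := xF; rewrite floor_verts // => xf; rewrite /Phi.
  rewrite (@pos_agree _ _ phi_dir); first by rewrite pos_phi_dir // addrK.
  move=> u ux; apply: comp; apply/negP => /andP[un /negP nf]; apply: nf.
  have [_ u0] := forest_root un; case/orP: xf => [/eqP x0|xf].
    by move: ux u0; rewrite x0 prefixs0 => /eqP ->.
  by have /andP[] := floor_closed words_prefix xf ux u0.
- split; last first.
    move=> x y xT yT; rewrite /Phi => e; have [ps1 ps2] := embeds_pos gd.
    suff : addr x = addr y by move=> a; rewrite -(addrK xT) a addrK.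
    case: (ndW _ (addr_words xT)) (ndW _ (addr_words yT)) => [/eqP x0|xn] [/eqP y0|yn].
    + by rewrite x0.
    + by case: (ps1 _ yn); rewrite -e x0.
    + by case: (ps1 _ xn); rewrite e y0.
    exact: ps2.
  split=> [x xT|x y xy]; first exact/placed/addr_words.
  have xT := adj_verts xy; have yT : y \in verts T by apply: (@adj_verts _ T y x);
    rewrite adj_sym.
  case: (adj_addr xy) => e; rewrite /Phi; last rewrite adj_sym; rewrite e; apply: child.
    by rewrite -e addr_words.
  by rewrite -e addr_words.
- have cE x y p : [fset x; y] = [fset vtx (parent p); vtx p] ->
      [fset Phi x; Phi y] = [fset Phi (vtx (parent p)); Phi (vtx p)].
    by case/fset2_inv => -[-> ->] //; rewrite fsetUC.
  move=> x y u v /edges_words[p pn pE] /edges_words[q qn qE].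
  rewrite (cE _ _ _ pE) (cE _ _ _ qE) !cPhi // => /(embeds_col_inj gd pn qn) pq.
  by rewrite pE qE pq.
move=> v p [vC _] [pp Up pv].
have ppT : path (adj T) v0 p by apply: sub_path pp => x y /and3P[].
have pN : p \in N by rewrite mem_words ppT.
have vT : v \in verts T by rewrite -pv vtx_verts.
move: vC; rewrite ceil_verts // -pv vtxK // => pc.
have preP e : e \in path_edges v0 p ->
  exists2 q, q \in lineage [::] p & e = [fset vtx (parent q); vtx q].
  by case/path_edges_words => q qp ->; exists q; rewrite ?mem_lineage.
have coordP x y q i : q \in lineage [::] p -> [fset x; y] = [fset vtx (parent q); vtx q] ->
    edge_coord (Phi x) (Phi y) i -> d q = i.
  rewrite mem_lineage // => /andP[qp q0] xy; have qN := words_prefix qp pN.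
  have qn : forest N [::] K q by rewrite forest_words qN; case: (q) q0.
  by case/fset2_inv: xy => -[-> ->]; [|move/edge_coord_sym]; apply: iPhi.
move=> x y u w i /preP[q qp qE] /preP[q' qp' qE'] /(coordP _ _ _ _ qp qE) dq /(coordP _ _ _ _ qp' qE') dq'.
rewrite qE qE'; suff -> : q = q' by [].
have [b bK pb] : exists2 b, b \in K & ceil_of N [::] [:: b] p.
  have /andP[pn pc'] : ceil_of N [::] K p.
    by case/orP: pc => // /eqP p0; move: qp; rewrite p0.
  by have [b bK [_ bp]] := forestP _ _ _ _ pn; exists b; rewrite // /ceil_of forest1 /desc pN bp.
have cl := ceil_closed words_prefix pb.
move: qp qp'; rewrite !mem_lineage // => /andP[qp q0] /andP[qp' q0'].
by apply: (embeds_ceil gd bK) (cl _ qp q0) (cl _ qp' q0') _; rewrite dq dq'.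
Qed.

End Extension.
End Tree.

Theorem theorem3p2 (V : choiceType) (T : graph V) (v0 : V)
    (G : graph cube) (C : Type) (c : {fset cube} -> C)
    (phi : V -> cube) (zbad : cube)
    (treeT : is_tree T) (v0T : v0 \in verts T) (T_nonempty : 0 < num_edges T)
    (GQ : cube_subgraph G) (c_proper : proper_coloring G c)
    (degG : num_edges T <= min_degree G)
    (phi_hom : homomorphism (floor_half T v0) G phi)
    (phi_dd : doubly_distinct (floor_half T v0) c phi)
    (zbad_adj : cube_adj (phi v0) zbad)
    (zbad_notG : ~~ adj G (phi v0) zbad)
    (zbad_coord : forall x y i, adj (floor_half T v0) x y ->
       edge_coord (phi v0) zbad i -> ~ edge_coord (phi x) (phi y) i) :
  exists Phi : V -> cube,
    [/\ extends (floor_half T v0) phi Phi,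
        embedding T (delete_vertex G zbad) Phi,
        rainbow T c Phi
      & path_distinct (ceil_half T v0) v0 Phi].
Proof.
exact: (extension treeT v0T GQ c_proper degG phi_hom phi_dd zbad_adj zbad_notG zbad_coord).
Qed.
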